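(* In any complete ontic model that satisfies ancilla independence, unitary invariance and parameter independence, every ontic model (i.e. the ontic model for every finite-dimensional quantum system in the collection) is $\psi$-complete.
   Context: A quantum system consists of a finite-dimensional Hilbert space $\mathcal{H}$ and sets $\mathcal{P}$ (preparations), $\mathcal{M}$ (measurements), $\mathcal{T}$ (transformations), together with surjective (possibly many-to-one) maps assigning to each $P\in\mathcal{P}$ a density operator $\rho$ on $\mathcal{H}$, to each $M\in\mathcal{M}$ a self-adjoint operator $A$ on $\mathcal{H}$, and to each $T\in\mathcal{T}$ a unitary $U$; we write $P_\rho, M_A, T_U$. For an eigenvalue $a$ of $A$, $[a]_A$ is the projection onto the eigenspace; quantum probabilities are $\mathrm{Tr}(U\rho U^*[a]_A)$. An ontic model for the system: a measurable space $(\Lambda,\Sigma)$; for each $M$ a Markov kernel (response function) $p_M(\cdot|\lambda)$, a probability distribution over eigenvalues of the operator representing $M$; for each $P$ a probability measure $\mu_P$ on $\Lambda$; for each $T$ a Markov kernel $\gamma_T$ from $\Lambda$ to itself; reproducing quantum predictions: $\int p_{M_A}(a|\lambda)\,d\mu_{P_\rho}(\lambda)=\mathrm{Tr}(\rho[a]_A)$ and $\iint p_{M_A}(a|\lambda)\gamma_{T_U}(d\lambda|\tilde\lambda)\,d\mu_{P_\rho}(\tilde\lambda)=\mathrm{Tr}(U\rho U^*[a]_A)$. The model is $\psi$-complete if for every preparation $P_\rho$, every measurement $M_A$ and every eigenvalue $a$ of $A$, $\int|p_{M_A}(a|\lambda)-\mathrm{Tr}(\rho[a]_A)|\,d\mu_{P_\rho}(\lambda)=0$.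 An ontic model satisfies unitary invariance if for all preparations $P_\rho$, transformations $T_U$, measurements $M_A$ and eigenvalues $a$: whenever $\mathrm{Tr}(\rho[a]_A)=\mathrm{Tr}(U\rho U^*[a]_A)$, then $p_{M_A}(a|\lambda)=\int p_{M_A}(a|\tilde\lambda)\gamma_{T_U}(d\tilde\lambda|\lambda)$ for $\mu_{P_\rho}$-almost every $\lambda$. A complete ontic model satisfies unitary invariance if all its ontic models do. Local measurements on a system with Hilbert space $\mathcal{H}_1\otimes\mathcal{H}_2$: operators $A\otimes\mathbf{1}$, $\mathbf{1}\otimes B$, or $A\otimes B$ (outcomes pairs $(a,b)$). Parameter independence: $p_{M_{A\otimes\mathbf{1}}}(a|\lambda)=\sum_b p_{M_{A\otimes B}}(a,b|\lambda)$ and $p_{M_{\mathbf{1}\otimes B}}(b|\lambda)=\sum_a p_{M_{A\otimes B}}(a,b|\lambda)$ for all $\lambda$, whenever the local procedures $M_{A\otimes\mathbf{1}}$, $M_{\mathbf{1}\otimes B}$ are those of which $M_{A\otimes B}$ consists. A complete ontic model is a collection of ontic models, one for every finite-dimensional quantum system, such that for every pair of systems with Hilbert spaces $\mathcal{H}_1,\mathcal{H}_2$ and for the system with Hilbert space $\mathcal{H}_1\otimes\mathcal{H}_2$, for each preparation $P_2$ of the second system there is a Markov kernel $\gamma_{P_2}$ from $(\Lambda_1,\Sigma_1)$ to $(\Lambda_{12},\Sigma_{12})$ such that for every preparation $P_1$ of the first system the measure $\mu_{P_1P_2}(\Delta)=\int\gamma_{P_2}(\Delta|\lambda)\,d\mu_{P_1}(\lambda)$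 is the measure of some preparation $P_1P_2$ of the joint system, represented by $\rho_1\otimes\rho_2$ when $P_1,P_2$ are represented by $\rho_1,\rho_2$. It satisfies parameter independence if all its ontic models do. It satisfies ancilla independence if for every response function $p_{M_A}$ of the first system's model there is a response function $p_{M_{A\otimes\mathbf{1}}}$ in the joint model such that for every preparation $P_2$ of the second system, $p_{M_A}(a|\lambda)=\int p_{M_{A\otimes\mathbf{1}}}(a|\tilde\lambda)\gamma_{P_2}(d\tilde\lambda|\lambda)$ for all outcomes $a$ and all $\lambda\in\Lambda_1$. *)

(* Defs.v *)
From HB Require Import structures.
From mathcomp Require Import all_boot all_order all_algebra.
From mathcomp Require Import complex mxtens.
From mathcomp Require Import all_classical all_reals all_analysis.

Set Implicit Arguments.
Unset Strict Implicit.
Unset Printing Implicit Defensive.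
Set Warnings "-uniform-inheritance".

Import Order.TTheory GRing.Theory Num.Theory.
Local Open Scope classical_set_scope.
Local Open Scope ring_scope.

(* Linear algebra on C^n, C = R[i], operators acting on column vectors *)
Section LinAlg.
Variable R : realType.
Local Notation C := R[i].

Definition adjmx m n (A : 'M[C]_(m, n)) : 'M[C]_(n, m) := (map_mx (@conjc R) A)^T.

Definition self_adjoint n (A : 'M[C]_n) : Prop := adjmx A = A.

Definition unitary n (U : 'M[C]_n) : Prop := U *m adjmx U = 1%:M.

Definition density n (rho : 'M[C]_n) : Prop :=
  [/\ adjmx rho = rho,
      forall x : 'cV[C]_n, 0 <= (adjmx x *m rho *m x) 0 0
    & \tr rho = 1].

Definition eigval n (A : 'M[C]_n) (a : R) : bool := eigenvalue A (a%:C)%C.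

(* [a]_A : the orthogonal projection onto the eigenspace {x | A x = a x}.
   The rows of B form a basis of {u (row) | u A^T = a u}, i.e. the columns
   of W := B^T form a basis of ker (A - a); the projection is
   W (W^* W)^-1 W^*. *)
Definition eigproj n (A : 'M[C]_n) (a : R) : 'M[C]_n :=
  let B := row_base (eigenspace A^T (a%:C)%C) in
  B^T *m invmx (adjmx (B^T) *m B^T) *m adjmx (B^T).

(* quantum probability Tr (rho E) (a real number for the E's used here) *)
Definition qprob n (rho E : 'M[C]_n) : R := @complex.Re R (\tr (rho *m E)).

End LinAlg.

Record qsystem (R : realType) (n : nat) := QSystem {
  Prep : Type;
  Meas : Type;
  Trans : Type;
  rho_of : Prep -> 'M[R[i]]_n;
  obs_of : Meas -> 'M[R[i]]_n;
  uop_of : Trans -> 'M[R[i]]_n;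
  rho_of_density : forall P, density (rho_of P);
  rho_of_surj : forall r, density r -> exists P, rho_of P = r;
  obs_of_sa : forall M, self_adjoint (obs_of M);
  obs_of_surj : forall A, self_adjoint A -> exists M, obs_of M = A;
  uop_of_unitary : forall T, unitary (uop_of T);
  uop_of_surj : forall U, unitary U -> exists T, uop_of T = U
}.

Arguments rho_of {R n S} _ : rename.
Arguments obs_of {R n S} _ : rename.
Arguments uop_of {R n S} _ : rename.

Definition conj_by (R : realType) n (U rho : 'M[R[i]]_n) := U *m rho *m adjmx U.

Record ontic_model (R : realType) (n : nat) (S : qsystem R n) := OnticModel {
  odisp : measure_display;
  Lam : measurableType odisp;
  resp : Meas S -> R -> Lam -> R;
  resp_measurable : forall M a, measurable_fun setT (resp M a);
  resp_ge0 : forall M a l, 0 <= resp M a l;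
  resp_supp : forall M a l, ~~ eigval (obs_of M) a -> resp M a l = 0;
  resp_sum1 : forall M l,
    (\sum_(a \in [set a | eigval (obs_of M) a]) resp M a l)%R = 1;
  prep : Prep S -> probability Lam R;
  trans : Trans S -> R.-pker Lam ~> Lam;
  reprod : forall P M a, eigval (obs_of M) a ->
    (\int[prep P]_l (resp M a l)%:E =
     (qprob (rho_of P) (eigproj (obs_of M) a))%:E)%E;
  reprod_trans : forall P T M a, eigval (obs_of M) a ->
    (\int[prep P]_l0 \int[trans T l0]_l (resp M a l)%:E =
     (qprob (conj_by (uop_of T) (rho_of P)) (eigproj (obs_of M) a))%:E)%E
}.

Arguments Lam {R n S} _.
Arguments resp {R n S} _ _ _ _.
Arguments prep {R n S} _ _.
Arguments trans {R n S} _ _.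

Definition psi_complete (R : realType) n (S : qsystem R n)
    (O : ontic_model S) : Prop :=
  forall (P : Prep S) (M : Meas S) (a : R), eigval (obs_of M) a ->
    (\int[prep O P]_l
       (`| resp O M a l - qprob (rho_of P) (eigproj (obs_of M) a) |)%:E = 0)%E.

Definition unitary_invariant (R : realType) n (S : qsystem R n)
    (O : ontic_model S) : Prop :=
  forall (P : Prep S) (T : Trans S) (M : Meas S) (a : R), eigval (obs_of M) a ->
    qprob (rho_of P) (eigproj (obs_of M) a) =
      qprob (conj_by (uop_of T) (rho_of P)) (eigproj (obs_of M) a) ->
    {ae prep O P, forall l,
      ((resp O M a l)%:E = \int[trans O T l]_l' (resp O M a l')%:E)%E}.

(* Finite-dimensional Hilbert spaces: C^(n+1) and formal tensor products *)
Inductive hspace := HBase of nat | HTens of hspace & hspace.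

Fixpoint hdim (h : hspace) : nat :=
  match h with
  | HBase n => n.+1
  | HTens h1 h2 => (hdim h1 * hdim h2)%N
  end.

(* Local (product) measurements M_{A (x) B} on the system H1 (x) H2,
   consisting of the local procedures M_{A (x) 1} and M_{1 (x) B};
   outcomes are pairs (a, b). *)
Record prod_meas (R : realType) (h1 h2 : hspace)
    (S : qsystem R (hdim (HTens h1 h2))) (O : ontic_model S) := ProdMeas {
  PM : Type;
  pmA : PM -> 'M[R[i]]_(hdim h1);
  pmB : PM -> 'M[R[i]]_(hdim h2);
  pm1 : PM -> Meas S;
  pm2 : PM -> Meas S;
  pm1E : forall m, obs_of (pm1 m) = pmA m *t 1%:M;
  pm2E : forall m, obs_of (pm2 m) = 1%:M *t pmB m;
  pm_all : forall (M1 M2 : Meas S) A B,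
    obs_of M1 = A *t 1%:M -> obs_of M2 = 1%:M *t B ->
    exists m, pm1 m = M1 /\ pm2 m = M2;
  presp : PM -> R -> R -> Lam O -> R;
  presp_measurable : forall m a b, measurable_fun setT (presp m a b);
  presp_ge0 : forall m a b l, 0 <= presp m a b l;
  presp_supp : forall m a b l, ~~ (eigval (pmA m) a && eigval (pmB m) b) ->
    presp m a b l = 0;
  presp_sum1 : forall m l,
    (\sum_(a \in [set a | eigval (pmA m) a])
       \sum_(b \in [set b | eigval (pmB m) b]) presp m a b l)%R = 1;
  preprod : forall P m a b, eigval (pmA m) a -> eigval (pmB m) b ->
    (\int[prep O P]_l (presp m a b l)%:E =
     (qprob (rho_of P) (eigproj (pmA m) a *t eigproj (pmB m) b))%:E)%E;
  preprod_trans : forall P T m a b, eigval (pmA m) a -> eigval (pmB m) b ->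
    (\int[prep O P]_l0 \int[trans O T l0]_l (presp m a b l)%:E =
     (qprob (conj_by (uop_of T) (rho_of P))
            (eigproj (pmA m) a *t eigproj (pmB m) b))%:E)%E
}.

Arguments PM {R h1 h2 S O} _.
Arguments pmA {R h1 h2 S O} _ _.
Arguments pmB {R h1 h2 S O} _ _.
Arguments pm1 {R h1 h2 S O} _ _.
Arguments pm2 {R h1 h2 S O} _ _.
Arguments presp {R h1 h2 S O} _ _ _ _ _.

Record complete_model (R : realType) := CompleteModel {
  sys : forall h : hspace, qsystem R (hdim h);
  om : forall h : hspace, ontic_model (sys h);
  pms : forall h1 h2 : hspace, prod_meas (om (HTens h1 h2));
  anc : forall (h1 h2 : hspace), Prep (sys h2) ->
          R.-pker (Lam (om h1)) ~> (Lam (om (HTens h1 h2)));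
  anc_prep : forall (h1 h2 : hspace) (P2 : Prep (sys h2)) (P1 : Prep (sys h1)),
    exists P12 : Prep (sys (HTens h1 h2)),
      rho_of P12 = rho_of P1 *t rho_of P2 /\
      forall D, measurable D ->
        prep (om (HTens h1 h2)) P12 D = (\int[prep (om h1) P1]_l @anc h1 h2 P2 l D)%E
}.

Arguments anc {R} _ {h1 h2} _.

Definition CM_unitary_invariant (R : realType) (CM : complete_model R) : Prop :=
  forall h, unitary_invariant (om CM h).

Definition CM_parameter_independent (R : realType) (CM : complete_model R) : Prop :=
  forall (h1 h2 : hspace) (m : PM (pms CM h1 h2)) (a b : R)
         (l : Lam (om CM (HTens h1 h2))),
    resp (om CM (HTens h1 h2)) (pm1 (pms CM h1 h2) m) a l =
      (\sum_(b' \in [set b' | eigval (pmB (pms CM h1 h2) m) b'])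
          presp (pms CM h1 h2) m a b' l)%R /\
    resp (om CM (HTens h1 h2)) (pm2 (pms CM h1 h2) m) b l =
      (\sum_(a' \in [set a' | eigval (pmA (pms CM h1 h2) m) a'])
          presp (pms CM h1 h2) m a' b l)%R.

Definition CM_ancilla_independent (R : realType) (CM : complete_model R) : Prop :=
  forall (h1 h2 : hspace) (M : Meas (sys CM h1)),
    exists M' : Meas (sys CM (HTens h1 h2)),
      obs_of M' = obs_of M *t 1%:M /\
      forall (P2 : Prep (sys CM h2)) (a : R) (l : Lam (om CM h1)),
        ((resp (om CM h1) M a l)%:E =
         \int[anc CM P2 l]_l' (resp (om CM (HTens h1 h2)) M' a l')%:E)%E.

(* Main.v *)
Require Import Defs.
From mathcomp Require Import all_boot all_order all_algebra.
From mathcomp Require Import complex mxtens.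
From mathcomp Require Import all_classical all_reals all_analysis.
From mathcomp Require Import measurable_realfun ring lra.

(** Let Q be the eigenprojection of the outcome a and q = Tr(rho Q) its
    quantum probability. As the response p(a|.) is nonnegative with integral
    q, it is enough to show p(a|.) >= q - e almost everywhere for every
    e > 0.

    By ancilla independence one may tensor the system with C^(d+1), so that
    the range and the kernel of Q contain enough orthonormal vectors f_k,
    and then add a second ancilla in a state sum_k s_k e_k (x) f_k; a
    unitary that swaps the system with the f-part of this ancilla preserves
    the probability of a, hence by unitary invariance leaves p(a|.)
    unchanged. Now the system is entangled with the e-part. If s_k = s_k',
    the chained Bell correlations between projections on span(f_k, f_k') and
    span(e_k, e_k'), together with parameter independence, show that the
    outcomes e_k and e_k' have the same probability for almost every ontic
    state. Perfect correlation between Q and the e_k with f_k in the range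
    of Q then bounds 1 - p(a|.) by K0 / (K0 + K1), where K0 (resp. K1) of
    the vectors with the common weight w lie in the kernel (resp. range) of
    Q. One further vector in the range, of weight less than w, makes the
    probability of a exactly q, and K0 / (K0 + K1) <= 1 - q + w with w as
    small as desired. *)

Set Implicit Arguments.
Unset Strict Implicit.
Unset Printing Implicit Defensive.

Import Order.TTheory GRing.Theory Num.Theory.
Local Open Scope classical_set_scope.
Local Open Scope ring_scope.

(** * Tensor products, adjoints and eigenprojections *)

Section Tensor.
Variable K : comPzRingType.

Lemma tensmxZl m n p q c (A : 'M[K]_(m, n)) (C : 'M[K]_(p, q)) :
  (c *: A) *t C = c *: (A *t C).
Proof. by apply/matrixP => i j; rewrite !mxE mulrA. Qed.

Lemma tensmxZr m n p q c (A : 'M[K]_(m, n)) (C : 'M[K]_(p, q)) :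
  A *t (c *: C) = c *: (A *t C).
Proof. by apply/matrixP => i j; rewrite !mxE mulrCA. Qed.

Lemma tensmxBl m n p q (A B : 'M[K]_(m, n)) (C : 'M[K]_(p, q)) :
  (A - B) *t C = A *t C - B *t C.
Proof. by apply/matrixP => i j; rewrite !mxE mulrBl. Qed.

Lemma tensmxBr m n p q (A : 'M[K]_(m, n)) (B C : 'M[K]_(p, q)) :
  A *t (B - C) = A *t B - A *t C.
Proof. by apply/matrixP => i j; rewrite !mxE mulrBr. Qed.

Lemma tensmx_suml (I : finType) m n p q (A : I -> 'M[K]_(m, n))
    (C : 'M[K]_(p, q)) :
  (\sum_i A i) *t C = \sum_i (A i *t C).
Proof.
apply/matrixP => i j; rewrite mxE !summxE mulr_suml.
by apply: eq_bigr => k _; rewrite mxE.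
Qed.

Lemma tensmx_sumr (I : finType) m n p q (A : 'M[K]_(m, n))
    (C : I -> 'M[K]_(p, q)) :
  A *t (\sum_i C i) = \sum_i (A *t C i).
Proof.
apply/matrixP => i j; rewrite mxE !summxE mulr_sumr.
by apply: eq_bigr => k _; rewrite mxE.
Qed.

Lemma tensmx11 m n : (1%:M : 'M[K]_m) *t (1%:M : 'M[K]_n) = 1%:M.
Proof.
apply/matrixP => i j; case: (mxtens_indexP i) => i0 i1.
case: (mxtens_indexP j) => j0 j1; rewrite tensmxE !mxE -natrM mulnb.
by rewrite (can_eq (@mxtens_indexK _ _)) xpair_eqE.
Qed.

Lemma tens_scalarl m n (c : K) : (c%:M : 'M[K]_m) *t (1%:M : 'M[K]_n) = c%:M.
Proof. by rewrite -(scalemx1 m c) tensmxZl tensmx11 scalemx1. Qed.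

Lemma tens_scalarr m n (c : K) : (1%:M : 'M[K]_m) *t (c%:M : 'M[K]_n) = c%:M.
Proof. by rewrite -(scalemx1 n c) tensmxZr tensmx11 scalemx1. Qed.

Lemma mxtrace_tens m n (A : 'M[K]_m) (B : 'M[K]_n) :
  \tr (A *t B) = \tr A * \tr B.
Proof.
by rewrite /mxtrace mulr_sum; apply: eq_bigr => k _; rewrite !mxE.
Qed.

Lemma delta_mulmx m n p q (A : 'M[K]_(n, p)) (i : 'I_m) j k (l : 'I_q) :
  delta_mx i j *m A *m delta_mx k l = A j k *: delta_mx i l.
Proof.
rewrite -mulmxA; apply/matrixP => x y; rewrite !mxE (bigD1 j)//= big1 ?addr0.
  rewrite !mxE (bigD1 k)//= big1 ?addr0.
    rewrite !mxE !eqxx/= andbT.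
    by case: (x == i); case: (y == l); rewrite ?(mul1r, mulr1, mul0r, mulr0).
  by move=> i0 ne; rewrite !mxE (negbTE ne)/= mulr0.
by move=> i0 ne; rewrite !mxE (negbTE ne) andbF mul0r.
Qed.

End Tensor.

Lemma tensmx_neq0 (K : idomainType) m n p q (A : 'M[K]_(m, n))
  (B : 'M[K]_(p, q)) : A != 0 -> B != 0 -> A *t B != 0.
Proof.
move=> /matrix0Pn[i [j Aij]] /matrix0Pn[k [l Bkl]].
apply/matrix0Pn; exists (mxtens_index (i, k)), (mxtens_index (j, l)).
by rewrite tensmxE mulf_neq0.
Qed.

Section Adjoint.
Variable R : realType.
Local Notation C := R[i].

Lemma adjmxM m n p (A : 'M[C]_(m, n)) (B : 'M[C]_(n, p)) :
  adjmx (A *m B) = adjmx B *m adjmx A.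
Proof. by rewrite /adjmx map_mxM trmx_mul. Qed.

Lemma adjmxK m n (A : 'M[C]_(m, n)) : adjmx (adjmx A) = A.
Proof. by apply/matrixP => i j; rewrite !mxE conjcK. Qed.

Lemma adjmxZ m n c (A : 'M[C]_(m, n)) : adjmx (c *: A) = conjc c *: adjmx A.
Proof. by rewrite /adjmx map_mxZ linearZ. Qed.

Lemma adjmx_sum (I : finType) m n (A : I -> 'M[C]_(m, n)) :
  adjmx (\sum_i A i) = \sum_i adjmx (A i).
Proof. by rewrite /adjmx map_mx_sum linear_sum. Qed.

Lemma adjmx1 n : adjmx (1%:M : 'M[C]_n) = 1%:M.
Proof. by rewrite /adjmx map_mx1 trmx1. Qed.

Lemma adjmx_delta m n i j : adjmx (delta_mx i j : 'M[C]_(m, n)) = delta_mx j i.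
Proof. by rewrite /adjmx map_delta_mx trmx_delta. Qed.

Lemma adjmx_tens m n p q (A : 'M[C]_(m, n)) (B : 'M[C]_(p, q)) :
  adjmx (A *t B) = adjmx A *t adjmx B.
Proof. by rewrite /adjmx map_mxT trmx_tens. Qed.

Lemma conjc_real (x : R) : conjc (x%:C)%C = (x%:C)%C.
Proof. by rewrite /= oppr0. Qed.

Lemma adjmx_sqE n (x : 'cV[C]_n) :
  (adjmx x *m x) 0 0 = \sum_i `|x i 0| ^+ 2.
Proof.
rewrite mxE; apply: eq_bigr => i _; rewrite !mxE.
by rewrite mulrC sqr_normc.
Qed.

Lemma adjmx_sq_ge0 n (x : 'cV[C]_n) : 0 <= (adjmx x *m x) 0 0.
Proof. by rewrite adjmx_sqE sumr_ge0// => i _; rewrite exprn_ge0. Qed.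

Lemma adjmx_sq_eq0 n (x : 'cV[C]_n) : (adjmx x *m x) 0 0 = 0 -> x = 0.
Proof.
rewrite adjmx_sqE => /psumr_eq0P H; apply/matrixP => i j.
rewrite mxE (ord1 j); apply/eqP; rewrite -normr_eq0 -sqrf_eq0.
by apply/eqP/H => // k _; rewrite exprn_ge0.
Qed.

(** If the Gram matrix kills v, then [W *m adjmx v] has norm 0, whence v = 0. So the [invmx] in
    [eigproj] is a true inverse. *)
Lemma adjmx_gram_unit n r (W : 'M[C]_(n, r)) :
  row_free W^T -> adjmx W *m W \in unitmx.
Proof.
move=> fW; rewrite -row_free_unit -kermx_eq0; apply/eqP/row_matrixP => i.
rewrite row0; set v := row i _.
have vG : v *m (adjmx W *m W) = 0.
  by apply/sub_kermxP; rewrite row_sub.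
have Wv : W *m adjmx v = 0.
  apply: adjmx_sq_eq0.
  by rewrite adjmxM adjmxK mulmxA -(mulmxA v) vG mul0mx mxE.
have: (adjmx v)^T *m W^T = 0 by rewrite -trmx_mul Wv trmx0.
move/eqP; rewrite mulmx_free_eq0// => /eqP v0.
by rewrite -(adjmxK v) -(trmxK (adjmx v)) v0 trmx0 -[RHS](adjmxK 0) /adjmx
  ?(map_mx0, trmx0).
Qed.

(* The factor [Z] says that ker (A - a) is contained in ker (1 - E); unlike a
   quantification over vectors, this form is stable under tensoring. *)
Definition is_eigproj n (A : 'M[C]_n) (a : R) (E : 'M[C]_n) :=
  [/\ adjmx E = E, A *m E = (a%:C)%C *: E
    & exists Z, 1%:M - E = Z *m (A - ((a%:C)%C)%:M)].

Lemma eigprojP n (A : 'M[C]_n) a : is_eigproj A a (eigproj A a).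
Proof.
rewrite /eigproj; set B := row_base _; set G := invmx _.
have uG : adjmx B^T *m B^T \in unitmx.
  by apply: adjmx_gram_unit; rewrite trmxK row_base_free.
have Gs : adjmx (adjmx B^T *m B^T) = adjmx B^T *m B^T.
  by rewrite adjmxM adjmxK.
have GsV : adjmx G = G.
  have GG : adjmx G *m (adjmx B^T *m B^T) = 1%:M.
    by rewrite -[X in _ *m X]Gs -adjmxM mulmxV// adjmx1.
  by rewrite -[LHS](mulmxK uG) GG mul1mx.
have AB : A *m B^T = (a%:C)%C *: B^T.
  have /eigenspaceP : (B <= eigenspace A^T (a%:C)%C)%MS by rewrite eq_row_base.
  by move=> /(congr1 trmx); rewrite trmx_mul trmxK linearZ.
split.
- by rewrite !adjmxM adjmxK GsV mulmxA.
- by rewrite !mulmxA AB -!scalemxAl.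
- set E := (X in 1%:M - X).
  (* The columns of [N] lie in ker (A - a), hence in the span of the columns of [B^T], which [E]
     fixes; so 1 - E vanishes on [N]. *)
  suff : (1%:M - E <= A - ((a%:C)%C)%:M)%MS by move/submxP.
  rewrite submxE; set N := cokermx _.
  have AN : A *m N = (a%:C)%C *: N.
    apply/eqP; rewrite -subr_eq0 -mul_scalar_mx -mulmxBl; apply/eqP.
    exact: mulmx_coker.
  have /submxP[D ND] : (N^T <= B)%MS.
    rewrite eq_row_base; apply/eigenspaceP.
    by rewrite -trmx_mul AN linearZ.
  have -> : N = B^T *m D^T by rewrite -trmx_mul -ND trmxK.
  rewrite mulmxBl mul1mx /E mulmxA -(mulmxA _ (adjmx B^T)) -(mulmxA B^T).
  by rewrite mulVmx// mulmx1 subrr.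
Qed.

(** By the factor [Z] each projection fixes the range of the other, so F E = E and E F = F; adjoints
    then give E = F. Eigenprojections can thus be computed by checking [is_eigproj]. *)
Lemma is_eigproj_eq n (A : 'M[C]_n) a E : is_eigproj A a E -> eigproj A a = E.
Proof.
move: (eigprojP A a); set F := eigproj _ _ => -[Fs AF [Z FZ]] [Es AE [Y EY]].
have FE : F *m E = E.
  apply/esym/eqP; rewrite -subr_eq0 -[X in X - _]mul1mx -mulmxBl FZ -mulmxA.
  by rewrite mulmxBl AE mul_scalar_mx subrr mulmx0.
have EF : E *m F = F.
  apply/esym/eqP; rewrite -subr_eq0 -[X in X - _]mul1mx -mulmxBl EY -mulmxA.
  by rewrite mulmxBl AF mul_scalar_mx subrr mulmx0.
by rewrite -EF -Es -Fs -adjmxM FE Es.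
Qed.

Lemma is_eigproj_fix n (A : 'M[C]_n) a E m (X : 'M[C]_(n, m)) :
  is_eigproj A a E -> A *m X = (a%:C)%C *: X -> E *m X = X.
Proof.
move=> [_ _ [Z EZ]] AX; apply/esym/eqP.
rewrite -subr_eq0 -[X in X - _]mul1mx -mulmxBl EZ -mulmxA.
by rewrite mulmxBl AX mul_scalar_mx subrr mulmx0.
Qed.

Lemma is_eigproj_idem n (A : 'M[C]_n) a E : is_eigproj A a E -> E *m E = E.
Proof. by move=> EA; apply: (is_eigproj_fix EA); case: EA. Qed.

Lemma is_eigproj_eigval n (A : 'M[C]_n) a E :
  self_adjoint A -> is_eigproj A a E -> E != 0 -> eigval A a.
Proof.
move=> As [Es AE _] /matrix0Pn[i [j Eij]].
have Ei : row i E != 0 by apply/matrix0Pn; exists 0, j; rewrite mxE.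
apply/eigenvalueP; exists (row i E) => //.
(* [eigenvalue] is about row vectors; taking adjoints turns A E = a E into E A = a E. *)
rewrite -row_mul; have -> : E *m A = (a%:C)%C *: E.
  by rewrite -[RHS]adjmxK adjmxZ conjc_real Es -AE adjmxM As Es.
by rewrite linearZ.
Qed.

Lemma eigval_eigproj_neq0 n (A : 'M[C]_n) a :
  self_adjoint A -> eigval A a -> eigproj A a != 0.
Proof.
move=> As /eigenvalueP[u uA u0]; apply: contraNneq u0 => E0.
have : eigproj A a *m adjmx u = adjmx u.
  apply: is_eigproj_fix (eigprojP A a) _.
  by rewrite -{1}As -adjmxM uA adjmxZ conjc_real.
by rewrite E0 mul0mx => /(congr1 (@adjmx _ _ _)); rewrite adjmxK => <-;
  rewrite /adjmx map_mx0 trmx0.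
Qed.

Lemma is_eigproj_tensl n m (A : 'M[C]_n) a E :
  is_eigproj A a E -> is_eigproj (A *t (1%:M : 'M[C]_m)) a (E *t 1%:M).
Proof.
move=> [Es AE [Z EZ]]; split.
- by rewrite adjmx_tens Es adjmx1.
- by rewrite tensmx_mul AE mul1mx tensmxZl.
- exists (Z *t 1%:M); rewrite -(tens_scalarl n m 1) -(tens_scalarl n m (a%:C)%C).
  by rewrite -!tensmxBl tensmx_mul mul1mx EZ.
Qed.

Lemma is_eigproj_tensr n m (A : 'M[C]_n) a E :
  is_eigproj A a E -> is_eigproj ((1%:M : 'M[C]_m) *t A) a (1%:M *t E).
Proof.
move=> [Es AE [Z EZ]]; split.
- by rewrite adjmx_tens Es adjmx1.
- by rewrite tensmx_mul AE mul1mx tensmxZr.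
- exists (1%:M *t Z); rewrite -(tens_scalarr m n 1) -(tens_scalarr m n (a%:C)%C).
  by rewrite -!tensmxBr tensmx_mul mul1mx EZ.
Qed.

Lemma is_eigproj_proj n (E : 'M[C]_n) :
  adjmx E = E -> E *m E = E -> is_eigproj E 1 E.
Proof.
move=> Es EE; split=> //; first by rewrite scale1r.
by exists (- 1%:M); rewrite mulNmx mul1mx opprB.
Qed.

(** The eigenvalues are among the real parts of the roots of the characteristic polynomial.
    Finiteness keeps sums over the spectrum from taking their default value 0. *)
Lemma finite_eigval n (A : 'M[C]_n) : finite_set [set a | eigval A a].
Proof.
have cp0 : char_poly A != 0 by rewrite monic_neq0 ?char_poly_monic.
have [s sP] := closed_field_poly_normal (char_poly A).
apply: (@sub_finite_set _ _ [set` map (@complex.Re R) s]) => [a|]; last first.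
  exact: finite_seq.
rewrite /= /eigval eigenvalue_root_char sP (monicP (char_poly_monic A)).
rewrite scale1r root_prod_XsubC => as_.
by apply/mapP; exists (a%:C)%C.
Qed.

Lemma tens_injl n m (A B : 'M[C]_n) : (0 < m)%N ->
  A *t (1%:M : 'M[C]_m) = B *t 1%:M -> A = B.
Proof.
case: m => // m _ AB; apply/matrixP => i j.
have /matrixP/(_ (mxtens_index (i, 0)) (mxtens_index (j, 0))) := AB.
by rewrite !tensmxE !mxE eqxx !mulr1.
Qed.

Lemma tens_injr n m (A B : 'M[C]_n) : (0 < m)%N ->
  (1%:M : 'M[C]_m) *t A = 1%:M *t B -> A = B.
Proof.
case: m => // m _ AB; apply/matrixP => i j.
have /matrixP/(_ (mxtens_index (0, i)) (mxtens_index (0, j))) := AB.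
by rewrite !tensmxE !mxE eqxx !mul1r.
Qed.

End Adjoint.

(** * The swap and the entangled state *)

Lemma mxtrace_sum (K : nzRingType) (I : finType) n (A : I -> 'M[K]_n) :
  \tr (\sum_i A i) = \sum_i \tr (A i).
Proof. exact: raddf_sum. Qed.

Section Swap.
Variables (R : realType) (n d : nat).
Local Notation C := R[i].

(* Exchanges the outer factors of C^n (x) (C^d (x) C^n). *)
Definition swapmx : 'M[C]_(n * (d * n)) :=
  \sum_i \sum_j (delta_mx i j : 'M[C]_n) *t ((1%:M : 'M[C]_d) *t delta_mx j i).

Lemma swapmx_adj : adjmx swapmx = swapmx.
Proof.
rewrite /swapmx adjmx_sum exchange_big/=; apply: eq_bigr => i _.
rewrite adjmx_sum; apply: eq_bigr => j _.
by rewrite !adjmx_tens !adjmx_delta adjmx1.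
Qed.

Lemma swapmx_conj (E : 'M[C]_n) (G : 'M[C]_d) :
  swapmx *m (E *t (G *t 1%:M)) *m swapmx = 1%:M *t (G *t E).
Proof.
(* In the first factor e_ij E e_kl = E_jk e_il, in the last e_ji 1 e_lk = 1_il e_jk: [E] and the
   identity change places. *)
have -> : swapmx *m (E *t (G *t 1%:M)) *m swapmx =
  \sum_i \sum_j \sum_k \sum_l (E j k *: (delta_mx i l : 'M[C]_n)) *t
      (G *t ((1%:M : 'M[C]_n) i l *: (delta_mx j k : 'M[C]_n))).
  rewrite /swapmx !mulmx_suml; apply: eq_bigr => i _.
  rewrite !mulmx_suml; apply: eq_bigr => j _.
  rewrite !mulmx_sumr; apply: eq_bigr => k _.
  rewrite !mulmx_sumr; apply: eq_bigr => l _.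
  by rewrite !tensmx_mul !delta_mulmx mul1mx mulmx1.
rewrite [in RHS](matrix_sum_delta E) !tensmx_sumr.
rewrite (exchange_big _ _ _ _ _ _) /=; apply: eq_bigr => j _.
rewrite !tensmx_sumr exchange_big/=; apply: eq_bigr => k _.
rewrite [X in _ = X *t _]mx1_sum_delta tensmx_suml; apply: eq_bigr => i _.
rewrite (bigD1 i)//= big1 ?addr0 => [|l li].
  by rewrite mxE eqxx scale1r tensmxZl !tensmxZr.
by rewrite mxE eq_sym (negbTE li) scale0r !tensmx0.
Qed.

Lemma swapmx_unitary : unitary swapmx.
Proof.
have := swapmx_conj 1%:M 1%:M.
by rewrite /unitary swapmx_adj !tensmx11 mulmx1.
Qed.

(** By cyclicity of the trace the swap acts on the observable instead; the first factor is left with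
    the identity, where [rho] contributes its trace 1. *)
Lemma qprob_swap (rho E : 'M[C]_n) (rho2 : 'M[C]_(d * n)) (G : 'M[C]_d) :
  \tr rho = 1 ->
  qprob (conj_by swapmx (rho *t rho2)) (E *t (G *t 1%:M)) =
  complex.Re (\tr (rho2 *m (G *t E))).
Proof.
move=> tr1; rewrite /qprob /conj_by swapmx_adj -!mulmxA mxtrace_mulC -!mulmxA.
by rewrite (mulmxA swapmx) swapmx_conj tensmx_mul mulmx1 mxtrace_tens tr1 mul1r.
Qed.

End Swap.

Section Entangled.
Variables (R : realType) (n d : nat) (F : 'M[R[i]]_(n, d)) (s : 'I_d -> R).
Local Notation C := R[i].

(** A vector in Schmidt form: amplitudes [s], Schmidt vectors e_k and the columns of [F]. The width
    [1 * 1] comes from tensoring two columns. *)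
Definition entvec : 'M[C]_(d * n, 1 * 1) :=
  \sum_k (s k)%:C%C *: ((delta_mx k 0 : 'M[C]_(d, 1)) *t col k F).

Definition entstate : 'M[C]_(d * n) := entvec *m adjmx entvec.

(** The expectation of G (x) E in the entangled state, expanded in the Schmidt vectors. *)
Definition entprob (E : 'M[C]_n) (G : 'M[C]_d) : R :=
  complex.Re
    (\sum_k \sum_l (s k * s l)%:C%C * (G k l * (adjmx F *m E *m F) k l)).

Lemma entprobE E G : complex.Re (\tr (entstate *m (G *t E))) = entprob E G.
Proof.
congr complex.Re; rewrite /entstate -mulmxA mxtrace_mulC /entvec adjmx_sum.
rewrite !mulmx_suml mxtrace_sum; apply: eq_bigr => k _.
rewrite mulmx_sumr mxtrace_sum; apply: eq_bigr => l _.
rewrite adjmxZ conjc_real adjmx_tens adjmx_delta -!scalemxAl -scalemxAr.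
rewrite !mxtraceZ !tensmx_mul mxtrace_tens mulrA -rmorphM; congr (_ * (_ * _)).
  by rewrite delta_mulmx mxtraceZ /mxtrace big_ord1 mxE !eqxx mulr1.
rewrite /mxtrace big_ord1 -mulmxA -mulmxA !mxE; apply: eq_bigr => i _.
by rewrite !mxE; congr (_ * _); apply: eq_bigr => j _; rewrite !mxE.
Qed.

Hypotheses (F1 : adjmx F *m F = 1%:M) (s1 : \sum_k s k ^+ 2 = 1).

Lemma entstate_density : density entstate.
Proof.
split.
- by rewrite /entstate adjmxM adjmxK.
- move=> x; rewrite /entstate mulmxA -(mulmxA _ (adjmx _) x).
  rewrite -[adjmx x *m _]adjmxK adjmxM adjmxK.
  exact: (@adjmx_sq_ge0 R 1).
- rewrite /entstate mxtrace_mulC /entvec adjmx_sum mulmx_suml mxtrace_sum.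
  rewrite -[RHS](rmorph1 (real_complex R)) -s1 rmorph_sum/=.
  apply: eq_bigr => k _.
  rewrite mulmx_sumr mxtrace_sum (bigD1 k)//= big1 ?addr0 => [|l lk].
    rewrite adjmxZ conjc_real adjmx_tens adjmx_delta -!scalemxAl -scalemxAr.
    rewrite !mxtraceZ !tensmx_mul mxtrace_tens mulrA -rmorphM.
    rewrite mul_delta_mx /mxtrace !big_ord1 !mxE eqxx mul1r.
    have /matrixP/(_ k k) := F1; rewrite !mxE eqxx => FF.
    rewrite (eq_bigr (fun i => adjmx F k i * F i k)); last first.
      by move=> i _; rewrite !mxE.
    by rewrite FF mulr1 expr2.
  rewrite adjmxZ conjc_real adjmx_tens adjmx_delta -!scalemxAl -scalemxAr.
  rewrite !mxtraceZ !tensmx_mul mxtrace_tens mul_delta_mx_0 1?eq_sym//.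
  by rewrite mxtrace0 mul0r !mulr0.
Qed.

Lemma entprob_isom (A G : 'M[C]_d) :
  entprob (F *m A *m adjmx F) G =
  complex.Re (\sum_k \sum_l (s k * s l)%:C%C * (G k l * A k l)).
Proof.
by rewrite /entprob !mulmxA F1 mul1mx -mulmxA F1 mulmx1.
Qed.

Lemma entprob1l (G : 'M[C]_d) :
  entprob 1%:M G = complex.Re (\sum_k (s k ^+ 2)%:C%C * G k k).
Proof.
rewrite /entprob mulmx1 F1; congr complex.Re; apply: eq_bigr => k _.
rewrite (bigD1 k)//= big1 ?addr0 => [|l lk].
  by rewrite mxE eqxx mulr1 expr2.
by rewrite mxE eq_sym (negbTE lk) !mulr0.
Qed.

Lemma entprob1r E :
  entprob E 1%:M =
  complex.Re (\sum_k (s k ^+ 2)%:C%C * (adjmx F *m E *m F) k k).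
Proof.
congr complex.Re; apply: eq_bigr => k _.
rewrite (bigD1 k)//= big1 ?addr0 => [|l lk].
  by rewrite mxE eqxx mul1r expr2.
by rewrite mxE eq_sym (negbTE lk) mul0r mulr0.
Qed.

End Entangled.

(** * Rank-one real projections and their correlations *)

Section RealProjector.
Variables (R : realType) (d : nat).
Local Notation C := R[i].

Definition dotr (u v : 'I_d -> R) : R := \sum_i u i * v i.

(** The orthogonal projection onto the line of a real vector, which is not normalised so that no
    square root appears. *)
Definition projr (u : 'I_d -> R) : 'M[C]_d :=
  \matrix_(i, j) (u i * u j / dotr u u)%:C%C.

Lemma projr_adj u : adjmx (projr u) = projr u.
Proof.
by apply/matrixP => i j; rewrite !mxE conjc_real (mulrC (u j)).
Qed.

Lemma projr_idem u : dotr u u != 0 -> projr u *m projr u = projr u.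
Proof.
move=> u0; apply/matrixP => i j; rewrite !mxE.
under eq_bigr do rewrite !mxE -rmorphM/=.
rewrite -rmorph_sum/=; congr (_%:C)%C.
transitivity (\sum_k (u i * u j / dotr u u / dotr u u) * (u k * u k)).
  by apply: eq_bigr => k _; ring.
rewrite -mulr_sumr -/(dotr u u); by field.
Qed.

Lemma projr_delta (k : 'I_d) (c : R) : c != 0 ->
  projr (fun i => if i == k then c else 0) = delta_mx k k.
Proof.
move=> c0; have -> : projr (fun i => if i == k then c else 0) =
    \matrix_(i, j) ((i == k) && (j == k))%:R.
  apply/matrixP => i j; rewrite !mxE /dotr (bigD1 k)//= big1 ?addr0 => [|l lk].
    rewrite eqxx; case: (i == k); case: (j == k); rewrite ?(mul0r, mulr0)//=.
    by rewrite divff// mulf_neq0.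
  by rewrite (negbTE lk) mul0r.
by apply/matrixP => i j; rewrite !mxE.
Qed.

Variables (n : nat) (F : 'M[C]_(n, d)) (s : 'I_d -> R) (r : R).
Hypothesis F1 : adjmx F *m F = 1%:M.

(** The relation between [s] and [u] says that [s] equals [r] on the support of [u]; on that block
    the state is a multiple of a maximally entangled one. *)
Lemma entprob_projr1 u : dotr u u != 0 ->
  (forall k, s k * u k = r * u k) -> entprob F s 1%:M (projr u) = r ^+ 2.
Proof.
move=> u0 su; rewrite entprob1l//.
under eq_bigr do rewrite mxE -rmorphM/=.
rewrite -rmorph_sum/=.
transitivity (\sum_k (r ^+ 2 / dotr u u) * (u k * u k)).
  apply: eq_bigr => k _.
  transitivity ((s k * u k) ^+ 2 / dotr u u); first by field.
  by rewrite su; field.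
by rewrite -mulr_sumr -/(dotr u u); field.
Qed.

Lemma entprob_1projr u : dotr u u != 0 ->
  (forall k, s k * u k = r * u k) ->
  entprob F s (F *m projr u *m adjmx F) 1%:M = r ^+ 2.
Proof.
move=> u0 su; rewrite -(entprob_projr1 u0 su) entprob1l// entprob1r//.
by rewrite !mulmxA F1 mul1mx -mulmxA F1 mulmx1.
Qed.

(** Every amplitude meets a component of [u] and can be replaced by [r]; what remains is the squared
    cosine of the angle between [u] and [v]. *)
Lemma entprob_projr u v : dotr u u != 0 -> dotr v v != 0 ->
  (forall k, s k * u k = r * u k) ->
  entprob F s (F *m projr u *m adjmx F) (projr v) =
  r ^+ 2 * (dotr u v ^+ 2 / (dotr u u * dotr v v)).
Proof.
move=> u0 v0 su; rewrite entprob_isom//.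
under eq_bigr do under eq_bigr do rewrite !mxE -!rmorphM/=.
under eq_bigr do rewrite -rmorph_sum/=.
rewrite -rmorph_sum/=.
transitivity (\sum_k \sum_l (r ^+ 2 / (dotr u u * dotr v v)) *
    ((u k * v k) * (u l * v l))).
  apply: eq_bigr => k _; apply: eq_bigr => l _.
  transitivity ((s k * u k) * (s l * u l) * (v k * v l / (dotr u u * dotr v v))).
    by field; rewrite u0 v0.
  by rewrite !su; field; rewrite u0 v0.
under eq_bigr do rewrite -mulr_sumr -mulr_sumr -/(dotr u v) mulrCA mulrC.
by rewrite -mulr_sumr -/(dotr u v); field; rewrite u0 v0.
Qed.

End RealProjector.

Section DiagObs.
Variables (R : realType) (d : nat).
Local Notation C := R[i].

(** Its spectrum is simple, so the outcome k singles out the basis vector e_k. *)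
Definition diagobs : 'M[C]_d := diag_mx (\row_k (k%:R : R)%:C%C).

Lemma diagobs_adj : self_adjoint diagobs.
Proof.
apply/matrixP => i j; rewrite !mxE eq_sym.
by case: (i =P j) => [->|_]; rewrite ?mulr1n ?mulr0n ?conjc_real// rmorph0.
Qed.

Lemma diagobs_eigproj (k : 'I_d) : is_eigproj diagobs k%:R (delta_mx k k).
Proof.
split.
- exact: adjmx_delta.
- apply/matrixP => i j; rewrite mul_diag_mx !mxE.
  by case: (i =P k) => [->//|_]; rewrite /= !mulr0.
(* This [Z] inverts D - k off the k-th position and is zero there. *)
- exists (diag_mx (\row_j if j == k then 0 else ((j%:R - k%:R : R)^-1)%:C%C)).
  apply/matrixP => i j; rewrite mul_diag_mx !mxE.
  case: (i =P k) => [->|/eqP ik]; rewrite /= ?mul0r.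
    by rewrite eq_sym subrr.
  case: (i =P j) => _; rewrite !subr0; last by rewrite mulr0n mulr0.
  rewrite !mulr1n -rmorphB -rmorphM mulVf ?rmorph1//.
  by rewrite subr_eq0 eqr_nat.
Qed.

Lemma eigval_diagobs (k : 'I_d) : eigval diagobs k%:R.
Proof.
apply: is_eigproj_eigval diagobs_adj (diagobs_eigproj k) _.
by apply/matrix0Pn; exists k, k; rewrite mxE eqxx oner_neq0.
Qed.

Lemma eigval_diagobsP b : eigval diagobs b -> exists k : 'I_d, b = k%:R.
Proof.
move=> /eigenvalueP[u uD /matrix0Pn[i [k uk]]]; exists k.
have /matrixP/(_ i k) := uD; rewrite mul_mx_diag !mxE mulrC.
by move=> /(mulIf uk) [].
Qed.

End DiagObs.

(** * Eigenvalues of tensor products *)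

Section Eigenvalues.
Variable R : realType.
Local Notation C := R[i].

Lemma is_eigproj_eigvalE n (A : 'M[C]_n) a E :
  self_adjoint A -> is_eigproj A a E -> eigval A a = (E != 0).
Proof.
move=> As AE; apply/idP/idP; last exact: is_eigproj_eigval AE.
by move/(eigval_eigproj_neq0 As); rewrite (is_eigproj_eq AE).
Qed.

Lemma self_adjoint_tens n m (A : 'M[C]_n) (B : 'M[C]_m) :
  self_adjoint A -> self_adjoint B -> self_adjoint (A *t B).
Proof. by rewrite /self_adjoint adjmx_tens => -> ->. Qed.

Lemma mx1_neq0 n : (0 < n)%N -> (1%:M : 'M[C]_n) != 0.
Proof.
case: n => // n _; apply/matrix0Pn; exists 0, 0.
by rewrite mxE eqxx oner_neq0.
Qed.

(** A number is an eigenvalue exactly when its eigenprojection is nonzero, and tensoring with the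
    identity of a nonzero space preserves this. *)
Lemma eigval_tensl n m (A : 'M[C]_n) a : (0 < m)%N -> self_adjoint A ->
  eigval (A *t (1%:M : 'M[C]_m)) a = eigval A a.
Proof.
move=> m0 As; have EA := eigprojP A a.
rewrite (is_eigproj_eigvalE As EA).
rewrite (is_eigproj_eigvalE _ (is_eigproj_tensl m EA)); last first.
  by apply: self_adjoint_tens => //; exact: adjmx1.
apply/idP/idP; first by apply: contraNneq => ->; rewrite tens0mx.
by move=> E0; rewrite tensmx_neq0// mx1_neq0.
Qed.

Lemma eigval_tensr n m (A : 'M[C]_n) a : (0 < m)%N -> self_adjoint A ->
  eigval ((1%:M : 'M[C]_m) *t A) a = eigval A a.
Proof.
move=> m0 As; have EA := eigprojP A a.
rewrite (is_eigproj_eigvalE As EA).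
rewrite (is_eigproj_eigvalE _ (is_eigproj_tensr m EA)); last first.
  by apply: self_adjoint_tens => //; exact: adjmx1.
apply/idP/idP; first by apply: contraNneq => ->; rewrite tensmx0.
by move=> E0; rewrite tensmx_neq0// mx1_neq0.
Qed.

Lemma unit_scaling n (y : 'cV[C]_n) : y != 0 ->
  exists c : R, adjmx (c%:C%C *: y) *m (c%:C%C *: y) = 1%:M.
Proof.
move=> y0; set N := (adjmx y *m y) 0 0.
have N0 : 0 <= N := adjmx_sq_ge0 y.
have NE : N = (complex.Re N)%:C%C.
  by case: N N0 => a b /=; rewrite lecE/= => /andP[/eqP-> _].
have r0 : 0 < complex.Re N.
  rewrite lt_def; apply/andP; split.
    apply: contra y0 => /eqP Re0; apply/eqP; apply: adjmx_sq_eq0.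
    by rewrite -/N NE Re0.
  by move: N0; rewrite lecE => /andP[_].
exists (Num.sqrt (complex.Re N))^-1.
apply/matrixP => i j; rewrite !ord1.
rewrite adjmxZ conjc_real -scalemxAl -scalemxAr scalerA.
rewrite [LHS]mxE -/N [X in _ * X]NE -!rmorphM/= -invfM -expr2 sqr_sqrtr ?ltW//.
by rewrite mulVf ?gt_eqF// mxE eqxx.
Qed.

End Eigenvalues.

Section FamilyIsom.
Variables (R : realType) (n d : nat) (v : 'I_d -> 'cV[R[i]]_n).
Local Notation C := R[i].

(** The factors e_k make the columns v_k (x) e_k orthogonal even when the v_k coincide. *)
Definition tens_family : 'M[C]_(n * d, d) :=
  \matrix_(x, k) ((v k : 'M[C]_(n, 1)) *t (delta_mx k 0 : 'M[C]_(d, 1))) x 0.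

Lemma tens_family_conj (E : 'M[C]_n) :
  adjmx tens_family *m (E *t 1%:M) *m tens_family =
  diag_mx (\row_k \tr (adjmx (v k) *m E *m v k)).
Proof.
apply/matrixP => k l.
have -> : (adjmx tens_family *m (E *t 1%:M) *m tens_family) k l =
    \tr (adjmx (v k *t (delta_mx k 0 : 'M[C]_(d, 1))) *m (E *t 1%:M) *m
      (v l *t (delta_mx l 0 : 'M[C]_(d, 1)))).
  rewrite /mxtrace big_ord1 -!mulmxA !mxE; apply: eq_bigr => i _.
  by rewrite !mxE; congr (_ * _); apply: eq_bigr => j _; rewrite !mxE.
rewrite adjmx_tens !tensmx_mul mxtrace_tens adjmx_delta delta_mulmx mxtraceZ.
rewrite !mxE [\tr (delta_mx _ _)]/mxtrace big_ord1 mxE !eqxx mulr1.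
by case: (k =P l) => [->|_]; rewrite ?mulr1 ?mulr0.
Qed.

End FamilyIsom.

(** * Mixtures and L1 distances of response functions *)

Section Mixture.
Context d1 d2 (X : measurableType d1) (Y : measurableType d2) (R : realType).
Variables (mu : probability X R) (k : R.-pker X ~> Y).

Lemma mixture_exists : exists nu : {measure set Y -> \bar R},
  (forall D, measurable D -> nu D = \int[mu]_x k x D)%E /\
  (forall f : Y -> R, (forall y, 0 <= f y)%R -> measurable_fun setT f ->
    \int[nu]_y (f y)%:E = \int[mu]_x \int[k x]_y (f y)%:E)%E.
Proof.
(* The law [mu] becomes a constant kernel, and [k2] ignores the extra first coordinate of a kernel
   composition; [point] is an arbitrary starting state. *)
pose l := kprobability (@measurable_cst _ _ X (pprobability X R) setT mu).
pose k2 := @kernel.kernel_snd _ _ _ X X Y R k.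
exists (mkcomp l k2 point); split=> // f f0 mf.
apply: (@integral_kcomp _ _ _ X X Y R l k2 point (EFin \o f)).
  by move=> z; rewrite lee_fin.
exact/measurable_EFinP.
Qed.

(** A null set N of the mixture is null for almost every component, as the nonnegative function x ->
    k x N has integral 0. *)
Lemma mixture_ae (nu : {measure set Y -> \bar R}) (P : Y -> Prop) :
  (forall D, measurable D -> nu D = \int[mu]_x k x D)%E ->
  {ae nu, forall y, P y} -> {ae mu, forall x, {ae k x, forall y, P y}}.
Proof.
move=> nuE [N [mN N0 PN]].
have mk : measurable_fun setT (k ^~ N) by exact: measurable_kernel.
have : ae_eq mu setT (k ^~ N) (cst 0%E).
  apply/(ae_eq_integral_abs mu measurableT mk).
  rewrite -[RHS]N0 nuE//; apply: eq_integral => x _.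
  by rewrite gee0_abs.
apply: filterS => x /(_ Logic.I) kx0; exists N; split=> //.
Qed.

End Mixture.

Section Bounds.
Context d (Y : measurableType d) (R : realType) (nu : {measure set Y -> \bar R}).
Implicit Types f g h : Y -> R.

Lemma ae_ge_integral f c : nu setT = 1%E -> measurable_fun setT f ->
  (forall y, 0 <= f y) -> {ae nu, forall y, c <= f y} ->
  (c%:E <= \int[nu]_y (f y)%:E)%E.
Proof.
move=> nu1 mf f0 cf; have [c0|c0] := ltP c 0.
  apply: (@le_trans _ _ 0%E); first by rewrite lee_fin ltW.
  by apply: integral_ge0 => y _; rewrite lee_fin.
have -> : c%:E = (\int[nu]_y (cst c%:E) y)%E.
  by rewrite integral_cst// nu1 mule1.
apply: ae_ge0_le_integral => //.
- by move=> y _; rewrite lee_fin.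
- exact/measurable_EFinP.
- by apply: filterS cf => y cy _; rewrite lee_fin.
Qed.

Lemma integral_cst1 : nu setT = 1%E -> (\int[nu]_y (cst 1%R y)%:E = 1%:E)%E.
Proof. by move=> nu1; rewrite (integral_cst _ measurableT 1%:E) nu1 mule1. Qed.

Definition L1close f g e := (\int[nu]_y (`|f y - g y|)%:E <= e%:E)%E.

Lemma L1closeC f g e : L1close f g e -> L1close g f e.
Proof. by rewrite /L1close; under eq_integral do rewrite distrC. Qed.

Lemma measurable_dist f g : measurable_fun setT f -> measurable_fun setT g ->
  measurable_fun setT (fun y => `|f y - g y|).
Proof.
by move=> mf mg; apply: measurableT_comp => //; exact: measurable_funB.
Qed.

Lemma L1close_trans f g h e1 e2 : measurable_fun setT f ->
  measurable_fun setT g -> measurable_fun setT h ->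
  L1close f g e1 -> L1close g h e2 -> L1close f h (e1 + e2).
Proof.
move=> mf mg mh fg gh; rewrite /L1close EFinD.
have mfg : measurable_fun setT (fun y => `|f y - g y|%:E).
  by apply/measurable_EFinP; exact: measurable_dist.
have mgh : measurable_fun setT (fun y => `|g y - h y|%:E).
  by apply/measurable_EFinP; exact: measurable_dist.
have mfh : measurable_fun setT (fun y => `|f y - h y|%:E).
  by apply/measurable_EFinP; exact: measurable_dist.
apply: le_trans (leeD fg gh); rewrite -ge0_integralD//.
apply: ge0_le_integral => //; first exact: emeasurable_funD.
move=> y _; rewrite -EFinD lee_fin.
by rewrite (le_trans _ (ler_normD _ _))// addrA subrK.
Qed.

Lemma L1close_ae f g : measurable_fun setT f -> measurable_fun setT g ->
  (forall e, 0 < e -> L1close f g e) -> {ae nu, forall y, f y = g y}.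
Proof.
move=> mf mg fg.
have I0 : (\int[nu]_y (`|f y - g y|)%:E = 0)%E.
  apply/eqP; rewrite eq_le integral_ge0 ?andbT; last first.
    by move=> y _; rewrite lee_fin.
  by apply/lee_addgt0Pr => e e0; rewrite add0e; exact: fg.
have : ae_eq nu setT (fun y => (`|f y - g y|)%:E) (cst 0%E).
  apply/ae_eq_integral_abs => //.
    by apply/measurable_EFinP; exact: measurable_dist.
  by rewrite -[RHS]I0; apply: eq_integral => y _; rewrite gee0_abs ?lee_fin.
apply: filterS => y /(_ Logic.I) [] /eqP.
by rewrite normr_eq0 subr_eq0 => /eqP.
Qed.

(** Pointwise |f - g| + 2 h <= f + g, since h lies below both. If h is the probability that two
    outcomes occur together, the bound is the probability that exactly one of them does. *)
Lemma L1close_joint f g h a b c :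
  measurable_fun setT f -> measurable_fun setT g -> measurable_fun setT h ->
  (forall y, 0 <= h y) -> (forall y, h y <= f y) -> (forall y, h y <= g y) ->
  (\int[nu]_y (f y)%:E = a%:E)%E -> (\int[nu]_y (g y)%:E = b%:E)%E ->
  (\int[nu]_y (h y)%:E = c%:E)%E -> L1close f g (a + b - 2 * c).
Proof.
move=> mf mg mh h0 hf hg If Ig Ih; rewrite /L1close.
have f0 y : 0 <= f y := le_trans (h0 y) (hf y).
have g0 y : 0 <= g y := le_trans (h0 y) (hg y).
have mfg : measurable_fun setT (fun y => (`|f y - g y|)%:E).
  by apply/measurable_EFinP; exact: measurable_dist.
have : (\int[nu]_y (`|f y - g y|%:E + ((h y)%:E + (h y)%:E)) <=
        \int[nu]_y ((f y)%:E + (g y)%:E))%E.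
  apply: ge0_le_integral => //.
  - by move=> y _; rewrite -!EFinD lee_fin !addr_ge0.
  - by do 2?apply: emeasurable_funD => //; exact/measurable_EFinP.
  - by apply: emeasurable_funD => //; exact/measurable_EFinP.
  - move=> y _; rewrite -!EFinD lee_fin; have := hf y; have := hg y.
    by case: (lerP (f y) (g y)) => _; lra.
rewrite !ge0_integralD//; try by
  [move=> y _; rewrite -?EFinD lee_fin ?addr_ge0//
  |exact/measurable_EFinP
  |apply: emeasurable_funD; exact/measurable_EFinP].
rewrite If Ig Ih -!EFinD => H.
have -> : a + b - 2 * c = (a + b) - (c + c) by ring.
by rewrite EFinB leeBrDr.
Qed.

End Bounds.

(** If f >= q - e/2, then |f - q| + q <= f + e; as f has mean q, integrating bounds the L1 distance
    by e. *)
Lemma ae_lower_bound_L1 d (Y : measurableType d) (R : realType)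
    (mu : {measure set Y -> \bar R}) (f : Y -> R) q :
  mu setT = 1%E -> measurable_fun setT f -> (forall y, 0 <= f y) ->
  (\int[mu]_y (f y)%:E = q%:E)%E ->
  (forall e, 0 < e -> {ae mu, forall y, q - e <= f y}) ->
  (\int[mu]_y (`|f y - q|)%:E = 0)%E.
Proof.
move=> mu1 mf f0 If fe.
have q0 : 0 <= q.
  rewrite -lee_fin -If; apply: integral_ge0 => y _; by rewrite lee_fin.
apply/eqP; rewrite eq_le integral_ge0 ?andbT; last first.
  by move=> y _; rewrite lee_fin.
apply/lee_addgt0Pr => e e0; rewrite add0e.
have mfq : measurable_fun setT (fun y => (`|f y - q|)%:E).
  by apply/measurable_EFinP; exact: measurable_dist.
have : (\int[mu]_y (`|f y - q|%:E + (cst q%:E) y) <=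
        \int[mu]_y ((f y)%:E + (cst e%:E) y))%E.
  apply: ae_ge0_le_integral => //.
  - by move=> y _; rewrite -!EFinD lee_fin !addr_ge0.
  - by apply: emeasurable_funD => //; exact/measurable_EFinP.
  - by move=> y _; rewrite -!EFinD lee_fin !addr_ge0// ltW.
  - by apply: emeasurable_funD => //; exact/measurable_EFinP.
  - have e20 : 0 < e / 2 by rewrite divr_gt0.
    apply: filterS (fe _ e20) => y fy _; rewrite -!EFinD lee_fin.
    by case: (lerP (f y) q) => ?; lra.
rewrite !ge0_integralD//; try by
  [move=> y _; rewrite /= lee_fin ltW
  |move=> y _; rewrite lee_fin
  |exact/measurable_EFinP].
rewrite If !integral_cst// mu1 !mule1 addeC => H.
by rewrite -(@leeD2lE _ q%:E).
Qed.

(** * Parameter independence *)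

Lemma hdim_gt0 h : (0 < hdim h)%N.
Proof. by elim: h => //= h1 H1 h2 H2; rewrite muln_gt0 H1. Qed.

Lemma fsum_ge_term (R : realType) (I : choiceType) (S : set I) (f : I -> R) b :
  finite_set S -> S b -> (forall x, 0 <= f x) -> f b <= \sum_(x \in S) f x.
Proof.
by move=> fS Sb f0; rewrite (fsbigD1 b)//= lerDl; apply: fsumr_ge0.
Qed.

Lemma self_adjoint_tensl_inv (R : realType) n m (A : 'M[R[i]]_n) :
  (0 < m)%N -> self_adjoint (A *t (1%:M : 'M[R[i]]_m)) -> self_adjoint A.
Proof.
move=> m0; rewrite /self_adjoint adjmx_tens adjmx1.
exact: tens_injl.
Qed.

Lemma self_adjoint_tensr_inv (R : realType) n m (A : 'M[R[i]]_n) :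
  (0 < m)%N -> self_adjoint ((1%:M : 'M[R[i]]_m) *t A) -> self_adjoint A.
Proof.
move=> m0; rewrite /self_adjoint adjmx_tens adjmx1.
exact: tens_injr.
Qed.

Lemma fsum_eigval_diagobs (R : realType) d m (f : R -> R) : (0 < m)%N ->
  \sum_(b \in [set b | eigval (diagobs R d *t (1%:M : 'M[R[i]]_m)) b]) f b =
  \sum_(k < d) f k%:R.
Proof.
move=> m0; rewrite (fsbig_ord _ _ (fun k => f k%:R)).
rewrite -(@fsbig_image _ _ _ _ _ `I_d (fun k : nat => k%:R : R) f); last first.
  by move=> x y _ _ /eqP; rewrite eqr_nat => /eqP.
apply: eq_fsbigl; apply/seteqP; split => b /=; rewrite eigval_tensl//;
  try exact: diagobs_adj.
  by move=> /eigval_diagobsP[k ->]; exists k => //=.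
by move=> [k /= kd <-]; exact: (eigval_diagobs R (Ordinal kd)).
Qed.

Lemma projr_neq0 (R : realType) d (u : 'I_d -> R) :
  dotr u u != 0 -> projr u != 0.
Proof.
move=> u0; apply/eqP => /(congr1 (fun A => \tr A)); rewrite mxtrace0 /mxtrace.
under eq_bigr do rewrite mxE.
rewrite -rmorph_sum -mulr_suml -/(dotr u u) divff// rmorph1.
by move/eqP; rewrite oner_eq0.
Qed.

(* [nu] is the law of the ontic state once [T] has been applied to [P]; it need
   not be the law of a preparation. *)
Definition transported (R : realType) n (S : qsystem R n) (O : ontic_model S)
    (P : Prep S) (T : Trans S) (nu : {measure set (Lam O) -> \bar R}) :=
  forall f : Lam O -> R, (forall y, 0 <= f y) -> measurable_fun setT f ->
    (\int[nu]_y (f y)%:E = \int[prep O P]_x \int[trans O T x]_y (f y)%:E)%E.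

Section ParameterIndependence.
Variables (R : realType) (CM : complete_model R).
Hypothesis pi : CM_parameter_independent CM.
Variables (h1 h2 : hspace).
Local Notation O := (om CM (HTens h1 h2)).
Variables (P : Prep (sys CM (HTens h1 h2))) (T : Trans (sys CM (HTens h1 h2))).
Variable nu : {measure set (Lam O) -> \bar R}.
Hypothesis nuE : transported P T nu.

Let sig := conj_by (uop_of T) (rho_of P).

Variables (M1 M2 : Meas (sys CM (HTens h1 h2))).
Variables (A : 'M[R[i]]_(hdim h1)) (B : 'M[R[i]]_(hdim h2)).
Hypotheses (M1E : obs_of M1 = A *t 1%:M) (M2E : obs_of M2 = 1%:M *t B).

Lemma obs_saA : self_adjoint A.
Proof.
apply: (self_adjoint_tensl_inv (hdim_gt0 h2)).
by rewrite -M1E; exact: obs_of_sa.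
Qed.

Lemma obs_saB : self_adjoint B.
Proof.
apply: (self_adjoint_tensr_inv (hdim_gt0 h1)).
by rewrite -M2E; exact: obs_of_sa.
Qed.

(** [pm_all] provides a product measurement made of exactly the procedures [M1] and [M2]. Parameter
    independence makes its marginals their responses at every ontic state, and its integrals under
    [nu] are quantum probabilities. *)
Lemma joint_resp : exists J : R -> R -> Lam O -> R,
  [/\ forall a b, measurable_fun setT (J a b), forall a b l, 0 <= J a b l,
      forall a l, resp O M1 a l = \sum_(b \in [set b | eigval B b]) J a b l,
      forall b l, resp O M2 b l = \sum_(a \in [set a | eigval A a]) J a b l
    & forall a b, eigval A a -> eigval B b ->
      (\int[nu]_l (J a b l)%:E =
       (qprob sig (eigproj A a *t eigproj B b))%:E)%E].
Proof.
have [m [m1 m2]] := @pm_all _ _ _ _ _ (pms CM h1 h2) _ _ _ _ M1E M2E.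
have mA : pmA (pms CM h1 h2) m = A.
  apply: (tens_injl (hdim_gt0 h2)).
  by have := pm1E m; rewrite m1 M1E => ->.
have mB : pmB (pms CM h1 h2) m = B.
  apply: (tens_injr (hdim_gt0 h1)).
  by have := pm2E m; rewrite m2 M2E => ->.
exists (presp (pms CM h1 h2) m); split.
- by move=> a b; exact: presp_measurable.
- by move=> a b l; exact: presp_ge0.
- by move=> a l; have [] := pi m a a l; rewrite m1 mB.
- by move=> b l; have [] := pi m b b l; rewrite m2 mA.
- move=> a b Aa Bb; rewrite nuE.
  + by rewrite preprod_trans ?mA ?mB.
  + by move=> y; exact: presp_ge0.
  + exact: presp_measurable.
Qed.

Lemma resp1_integral a : eigval A a ->
  (\int[nu]_l (resp O M1 a l)%:E = (qprob sig (eigproj A a *t 1%:M))%:E)%E.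
Proof.
move=> Aa; rewrite nuE; last 2 first.
- by move=> y; exact: resp_ge0.
- exact: resp_measurable.
rewrite reprod_trans; last first.
  by rewrite M1E eigval_tensl ?hdim_gt0//; exact: obs_saA.
rewrite M1E; congr (_%:E); congr qprob.
by apply: is_eigproj_eq; apply: is_eigproj_tensl; exact: eigprojP.
Qed.

Lemma resp2_integral b : eigval B b ->
  (\int[nu]_l (resp O M2 b l)%:E = (qprob sig (1%:M *t eigproj B b))%:E)%E.
Proof.
move=> Bb; rewrite nuE; last 2 first.
- by move=> y; exact: resp_ge0.
- exact: resp_measurable.
rewrite reprod_trans; last first.
  by rewrite M2E eigval_tensr ?hdim_gt0//; exact: obs_saB.
rewrite M2E; congr (_%:E); congr qprob.
by apply: is_eigproj_eq; apply: is_eigproj_tensr; exact: eigprojP.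
Qed.

(** The bound is the quantum probability that exactly one of the outcomes [a] and [b] occurs. *)
Lemma resp_close a b : eigval A a -> eigval B b ->
  L1close nu (resp O M1 a) (resp O M2 b)
    (qprob sig (eigproj A a *t 1%:M) + qprob sig (1%:M *t eigproj B b)
     - 2 * qprob sig (eigproj A a *t eigproj B b)).
Proof.
move=> Aa Bb; have [J [mJ J0 J1 J2 IJ]] := joint_resp.
apply: (@L1close_joint _ _ _ _ _ _ (J a b)) => //.
- exact: resp_measurable.
- exact: resp_measurable.
- by move=> y; rewrite J1; apply: (fsum_ge_term (finite_eigval B)).
- move=> y; rewrite J2.
  exact: (@fsum_ge_term _ _ _ (J ^~ b ^~ y) _ (finite_eigval A)).
- exact: resp1_integral.
- exact: resp2_integral.
- exact: IJ.
Qed.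

End ParameterIndependence.

(** * The chained Bell argument *)

Section ChainVectors.
Variables (R : realType) (d : nat) (k k' : 'I_d) (N : nat).
Hypotheses (kk' : k' != k) (N0 : (0 < N)%N).

(* Instead of rotating e_k to e_k' by equal angles, the chain runs along the
   segment from N e_k to N e_k'; this keeps all the projections rational. *)
Definition chainvec (t : nat) (i : 'I_d) : R :=
  if i == k then N%:R - t%:R else if i == k' then t%:R else 0.

Lemma dotr_chainvec s t :
  dotr (chainvec s) (chainvec t) =
  (N%:R - s%:R) * (N%:R - t%:R) + s%:R * t%:R.
Proof.
rewrite /dotr (bigD1 k)//= (bigD1 k')//= big1 ?addr0 => [|i /andP[ik ik']].
  by rewrite /chainvec !eqxx (negbTE kk').
by rewrite /chainvec (negbTE ik) (negbTE ik') mul0r.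
Qed.

(** Twice the squared norm is N^2 + (N - 2t)^2. *)
Lemma dotr_chainvec_ge t :
  N%:R ^+ 2 / 2 <= dotr (chainvec t) (chainvec t) :> R.
Proof.
rewrite dotr_chainvec.
have := sqr_ge0 (N%:R - 2 * t%:R : R); set x := N%:R; set y := t%:R => H.
by nra.
Qed.

Lemma dotr_chainvec_gt0 t : 0 < dotr (chainvec t) (chainvec t).
Proof.
apply: lt_le_trans (dotr_chainvec_ge t).
by rewrite divr_gt0// exprn_gt0// ltr0n.
Qed.

(** The left side is the squared sine of the angle between neighbours: their Gram determinant N^2
    over the product of their squared norms, each at least N^2 / 2. *)
Lemma chainvec_step t :
  1 - dotr (chainvec t) (chainvec t.+1) ^+ 2 /
    (dotr (chainvec t) (chainvec t) * dotr (chainvec t.+1) (chainvec t.+1))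
  <= 4 / N%:R ^+ 2.
Proof.
have Np : 0 < N%:R :> R by rewrite ltr0n.
have := dotr_chainvec_ge t; have := dotr_chainvec_ge t.+1.
have := dotr_chainvec_gt0 t; have := dotr_chainvec_gt0 t.+1.
have : dotr (chainvec t) (chainvec t) * dotr (chainvec t.+1) (chainvec t.+1)
  - dotr (chainvec t) (chainvec t.+1) ^+ 2 = N%:R ^+ 2.
  by rewrite !dotr_chainvec -natr1; ring.
set x := dotr _ _; set y := dotr _ _; set z := dotr _ _ => E y0 x0 yN xN.
rewrite -[X in X - _](@divff _ (x * y)) ?mulf_neq0 ?gt_eqF//.
rewrite -mulrBl E ler_pdivrMr ?mulr_gt0//.
have {1}-> : N%:R ^+ 2 = 4 / N%:R ^+ 2 * ((N%:R ^+ 2 / 2) * (N%:R ^+ 2 / 2)) :> R.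
  by field; rewrite gt_eqF.
apply: ler_wpM2l; first by rewrite divr_ge0// exprn_ge0// ltW.
by apply: ler_pM => //; rewrite divr_ge0// exprn_ge0// ltW.
Qed.

Lemma projr_chainvec0 : projr (chainvec 0) = delta_mx k k.
Proof.
rewrite -(@projr_delta R _ k N%:R) ?pnatr_eq0 -?lt0n//; congr projr.
apply/funext => i; rewrite /chainvec subr0.
by case: (i == k); case: (i == k').
Qed.

Lemma projr_chainvecN : projr (chainvec N) = delta_mx k' k'.
Proof.
rewrite -(@projr_delta R _ k' N%:R) ?pnatr_eq0 -?lt0n//; congr projr.
apply/funext => i; rewrite /chainvec subrr.
by case: (i =P k) => [->|//]; rewrite eq_sym (negbTE kk').
Qed.

End ChainVectors.

Section ChainedBell.
Variables (R : realType) (CM : complete_model R).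
Hypothesis pi : CM_parameter_independent CM.
Variables (h : hspace) (d : nat).
Local Notation hB := (HTens (HBase d) h).
Local Notation O := (om CM (HTens h hB)).
Variables (F : 'M[R[i]]_(hdim h, d.+1)) (s : 'I_d.+1 -> R).
Hypothesis F1 : adjmx F *m F = 1%:M.
Variables (P : Prep (sys CM (HTens h hB))) (T : Trans (sys CM (HTens h hB))).
Variable rho : 'M[R[i]]_(hdim h).
Hypotheses (tr1 : \tr rho = 1) (PE : rho_of P = rho *t entstate F s).
Hypothesis TE : uop_of T = swapmx R (hdim h) d.+1.
Variable nu : {measure set (Lam O) -> \bar R}.
Hypothesis nuE : transported P T nu.

Local Notation sig := (conj_by (uop_of T) (rho_of P)).

Lemma qprob_sig E G : qprob sig (E *t (G *t 1%:M)) = entprob F s E G.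
Proof. by rewrite PE TE qprob_swap// entprobE. Qed.

Lemma qprob_sig1 E : qprob sig (E *t 1%:M) = entprob F s E 1%:M.
Proof. by rewrite -qprob_sig tensmx11. Qed.

Definition bobs (B : 'M[R[i]]_d.+1) : 'M[R[i]]_(hdim h * (d.+1 * hdim h)) :=
  1%:M *t (B *t 1%:M).

Lemma bobs_close (MA MB : Meas (sys CM (HTens h hB))) A a E B b G :
  obs_of MA = A *t 1%:M -> obs_of MB = bobs B ->
  is_eigproj A a E -> is_eigproj B b G -> eigval A a -> eigval B b ->
  L1close nu (resp O MA a) (resp O MB b)
    (entprob F s E 1%:M + entprob F s 1%:M G - 2 * entprob F s E G).
Proof.
move=> MAE MBE AE BG Aa Bb.
have Bs : self_adjoint B.
  have := obs_saB MBE; exact: self_adjoint_tensl_inv (hdim_gt0 h).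
have Bb' : eigval (B *t (1%:M : 'M[R[i]]_(hdim h))) b.
  by rewrite eigval_tensl ?hdim_gt0.
have := resp_close pi nuE MAE MBE Aa Bb'.
rewrite (is_eigproj_eq AE) (is_eigproj_eq (is_eigproj_tensl (hdim h) BG)).
by rewrite !qprob_sig qprob_sig1.
Qed.

(* [g] is the probability of an outcome with eigenprojection [projr u] of some
   measurement on the C^(d+1) factor. *)
Definition bresp (u : 'I_d.+1 -> R) (g : Lam O -> R) :=
  exists (MB : Meas (sys CM (HTens h hB))) B b,
    [/\ obs_of MB = bobs B, is_eigproj B b (projr u), eigval B b
      & g = resp O MB b].

Lemma bresp_measurable u g : bresp u g -> measurable_fun setT g.
Proof. by move=> [MB [B [b [_ _ _ ->]]]]; exact: resp_measurable. Qed.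

Lemma bresp_exists u : dotr u u != 0 -> exists g, bresp u g.
Proof.
move=> u0.
have [|MB MBE] := @obs_of_surj _ _ (sys CM (HTens h hB)) (bobs (projr u)).
  apply: self_adjoint_tens; first exact: adjmx1.
  by apply: self_adjoint_tens; [exact: projr_adj|exact: adjmx1].
have pu := is_eigproj_proj (projr_adj u) (projr_idem u0).
exists (resp O MB 1), MB, (projr u), 1; split=> //.
by apply: is_eigproj_eigval pu _; [exact: projr_adj|exact: projr_neq0].
Qed.

Variable r : R.

Lemma bresp_close u v g g' : dotr u u != 0 -> dotr v v != 0 ->
  (forall k, s k * u k = r * u k) -> (forall k, s k * v k = r * v k) ->
  bresp u g -> bresp v g' ->
  L1close nu g g'
    (2 * r ^+ 2 * (1 - dotr u v ^+ 2 / (dotr u u * dotr v v))).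
Proof.
move=> u0 v0 su sv bu bv.
have mg := bresp_measurable bu; have mg' := bresp_measurable bv.
move: bu bv => [MB [B [b [MBE BG Bb gE]]]] [MB' [B' [b' [MB'E BG' Bb' gE']]]].
(* The measurement of the mirror projection on the other side is perfectly
   correlated with [g] and nearly perfectly correlated with [g']. *)
pose E := F *m projr u *m adjmx F.
have Es : adjmx E = E by rewrite /E !adjmxM adjmxK projr_adj mulmxA.
have EE : E *m E = E.
  rewrite /E !mulmxA -(mulmxA _ (adjmx F) F) F1 mulmx1.
  by rewrite -(mulmxA F) projr_idem.
have EP := is_eigproj_proj Es EE.
have E0 : E != 0.
  have := projr_neq0 u0; apply: contraNneq => E0.
  have <- : adjmx F *m E *m F = projr u.
    by rewrite /E !mulmxA F1 mul1mx -mulmxA F1 mulmx1.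
  by rewrite E0 mulmx0 mul0mx.
have [|MA MAE] := @obs_of_surj _ _ (sys CM (HTens h hB)) (E *t 1%:M).
  by apply: self_adjoint_tens => //; exact: adjmx1.
have E1 : eigval E 1 by exact: is_eigproj_eigval EP E0.
have cA := bobs_close MAE MBE EP BG E1 Bb.
have cB := bobs_close MAE MB'E EP BG' E1 Bb'.
rewrite -gE in cA; rewrite -gE' in cB.
have := L1close_trans mg (resp_measurable _ _) mg' (L1closeC cA) cB.
rewrite /E (entprob_1projr F1 u0 su) (entprob_projr1 F1 u0 su).
rewrite (entprob_projr1 F1 v0 sv).
rewrite (entprob_projr F1 u0 u0 su) (entprob_projr F1 u0 v0 su).
congr (L1close _ _ _ _).
rewrite -(expr2 (dotr u u)) divff ?expf_neq0//; ring.
Qed.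

(** Each link costs 2 r^2 times a squared sine of at most 4 / N^2. The cost is quadratic in 1 / N,
    so N links together cost only 8 r^2 / N. *)
Lemma bresp_chain (k k' : 'I_d.+1) N t g g' : k' != k -> (0 < N)%N ->
  s k = r -> s k' = r ->
  bresp (chainvec R k k' N 0) g -> bresp (chainvec R k k' N t) g' ->
  L1close nu g g' (t%:R * (8 * r ^+ 2 / N%:R ^+ 2)).
Proof.
move=> kk' N0 sk sk' bg.
have sv t' i : s i * chainvec R k k' N t' i = r * chainvec R k k' N t' i.
  rewrite /chainvec; case: (i =P k) => [->|_]; first by rewrite sk.
  by case: (i =P k') => [->|_]; rewrite ?sk' ?mulr0.
have dv t' := lt0r_neq0 (dotr_chainvec_gt0 R kk' N0 t').
elim: t g' => [|t IH] g' bg'.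
  (* Two measurements of the same projection may have different response functions, but both agree
     with the mirror measurement up to distance 0. *)
  have := bresp_close (dv 0%N) (dv 0%N) (sv 0%N) (sv 0%N) bg bg'.
  by rewrite -(expr2 (dotr _ _)) divff ?expf_neq0// subrr mulr0 mul0r.
have [f bf] := bresp_exists (dv t).
have := bresp_close (dv t) (dv t.+1) (sv t) (sv t.+1) bf bg'.
have := IH f bf => c1 c2.
have := L1close_trans (bresp_measurable bg) (bresp_measurable bf)
  (bresp_measurable bg') c1 c2.
move=> /le_trans; apply; rewrite lee_fin -[t.+1%:R]natr1 (mulrDl t%:R 1).
rewrite mul1r lerD2l.
have -> : 8 * r ^+ 2 / N%:R ^+ 2 = 2 * r ^+ 2 * (4 / N%:R ^+ 2) by ring.
apply: ler_wpM2l; first by rewrite mulr_ge0// sqr_ge0.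
exact: chainvec_step.
Qed.

Lemma bresp_equal (MD : Meas (sys CM (HTens h hB))) (k k' : 'I_d.+1) :
  obs_of MD = bobs (diagobs R d.+1) -> s k = r -> s k' = r ->
  {ae nu, forall l, resp O MD k%:R l = resp O MD k'%:R l}.
Proof.
move=> MDE sk sk'; have [->|kk'] := eqVneq k' k.
  exact: aeW.
apply: L1close_ae; [exact: resp_measurable|exact: resp_measurable|].
move=> e e0.
have bd (j : 'I_d.+1) u : projr u = delta_mx j j ->
    bresp u (resp O MD j%:R).
  move=> uj; exists MD, (diagobs R d.+1), j%:R; rewrite uj; split=> //.
    exact: diagobs_eigproj.
  exact: eigval_diagobs.
(* The N links cost 8 r^2 / N in total, which is less than e for this N. *)
pose N := (Num.truncn (8 * r ^+ 2 / e)).+1.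
have N0 : (0 < N)%N by [].
have := bresp_chain kk' N0 sk sk' (bd k _ (projr_chainvec0 R k k' N0))
  (bd k' _ (projr_chainvecN R kk' N0)).
move=> /le_trans; apply; rewrite lee_fin.
have Np : 0 < N%:R :> R by rewrite ltr0n.
have -> : N%:R * (8 * r ^+ 2 / N%:R ^+ 2) = 8 * r ^+ 2 / N%:R.
  by field; rewrite gt_eqF.
rewrite ler_pdivrMr// [leRHS]mulrC -ler_pdivrMr// ltW//.
exact: truncnS_gt.
Qed.

Variable chi : pred 'I_d.+1.
Variables (MA MD : Meas (sys CM (HTens h hB))) (A : 'M[R[i]]_(hdim h)) (a : R).
Hypotheses (MAE : obs_of MA = A *t 1%:M).
Hypothesis MDE : obs_of MD = bobs (diagobs R d.+1).
Hypothesis Aa : eigval A a.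
Hypothesis Achi :
  adjmx F *m eigproj A a *m F = diag_mx (\row_k (chi k)%:R).

(** By [Achi] the k-th column of [F] lies in the range of the eigenprojection if [chi k] holds and
    in its kernel otherwise, so k and [a] are perfectly correlated. *)
Lemma entprob_chi (k : 'I_d.+1) :
  entprob F s (eigproj A a) (delta_mx k k) = s k ^+ 2 * (chi k)%:R.
Proof.
rewrite /entprob Achi (bigD1 k)//= (bigD1 k)//= big1; last first.
  by move=> i ik; rewrite !mxE (negbTE ik) andbF mul0r mulr0.
rewrite addr0 [X in _ + X]big1 ?addr0; last first.
  move=> i ik; rewrite big1// => j _.
  by rewrite !mxE (negbTE ik) mul0r mulr0.
rewrite !mxE !eqxx mulr1n mul1r -expr2.
by case: (chi k); rewrite ?mulr1 ?mulr0.
Qed.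

Lemma entprob_1delta (k : 'I_d.+1) :
  entprob F s 1%:M (delta_mx k k) = s k ^+ 2.
Proof.
rewrite entprob1l// (bigD1 k)//= big1 => [|i ik].
  by rewrite addr0 mxE !eqxx mulr1.
by rewrite mxE (negbTE ik) mulr0.
Qed.

(** An outcome k with [chi k] almost surely entails [a], so 1 - p(a) is at most the total
    probability of the other k. By the chain these have the same probability x as all outcomes of
    amplitude [r], so x is at most 1 over the number of the latter. *)
Lemma ae_resp_transported_ge (k0 : 'I_d.+1) :
  s k0 = r -> (forall k, ~~ chi k -> s k = r) ->
  {ae nu, forall l,
    1 - #|[pred k | ~~ chi k]|%:R / #|[pred k | s k == r]|%:R <= resp O MA a l}.
Proof.
move=> sk0 schi.
have [J [mJ J0 J1 J2 IJ]] := joint_resp pi nuE MAE MDE.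
have Dk (k : 'I_d.+1) : eigval (diagobs R d.+1 *t (1%:M : 'M[R[i]]_(hdim h))) k%:R.
  by rewrite eigval_tensl ?hdim_gt0 ?eigval_diagobs//; exact: diagobs_adj.
(* When [chi k], the joint outcome (a, k) lies below k pointwise and has the same integral. *)
have Jae (k : 'I_d.+1) : {ae nu, forall l, chi k -> resp O MD k%:R l = J a k%:R l}.
  case: (boolP (chi k)) => [ck|_]; last exact: aeW.
  suff : {ae nu, forall l, resp O MD k%:R l = J a k%:R l}.
    by apply: filterS.
  apply: L1close_ae => [|//|e e0]; first exact: resp_measurable.
  have ID := resp2_integral nuE MDE (Dk k).
  have IJk := IJ a k%:R Aa (Dk k).
  have := L1close_joint (resp_measurable _ _) (mJ a k%:R) (mJ a k%:R)
    (J0 a k%:R) _ (fun=> lexx _) ID IJk IJk.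
  rewrite (is_eigproj_eq (is_eigproj_tensl (hdim h) (diagobs_eigproj R k))).
  rewrite !qprob_sig entprob_chi entprob_1delta ck mulr1.
  move=> H; apply: le_trans (H _) _.
    move=> y; rewrite J2.
    exact: (@fsum_ge_term _ _ _ (J ^~ k%:R ^~ y) _ (finite_eigval A)).
  by rewrite lee_fin; lra.
have Dae (k : 'I_d.+1) : {ae nu, forall l, s k = r ->
    resp O MD k%:R l = resp O MD k0%:R l}.
  case: (eqVneq (s k) r) => [sk|/eqP sk]; last exact: aeW.
  by apply: filterS (bresp_equal MDE sk sk0).
have Jall : {ae nu, forall l, forall k, chi k -> resp O MD k%:R l = J a k%:R l}.
  exact: filter_forall.
have Dall : {ae nu, forall l, forall k, s k = r ->
    resp O MD k%:R l = resp O MD k0%:R l}.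
  exact: filter_forall.
apply: filterS2 Jall Dall => l Jl Dl.
have sum1 : \sum_(k < d.+1) resp O MD k%:R l = 1.
  have E := fsum_eigval_diagobs d.+1 (resp O MD ^~ l) (hdim_gt0 h).
  rewrite -[RHS](resp_sum1 MD l) MDE; apply: (etrans (esym E)).
  apply: eq_fsbigl; apply/seteqP; split => b /=;
    rewrite eigval_tensr ?hdim_gt0//; apply: self_adjoint_tens;
    by [exact: diagobs_adj|exact: adjmx1].
set x := resp O MD k0%:R l in Dl.
have x0 : 0 <= x by exact: resp_ge0.
have Kpos : (0 < #|[pred k | s k == r]|)%N.
  by apply/card_gt0P; exists k0; rewrite inE /= sk0.
have Kx : #|[pred k | s k == r]|%:R * x <= 1.
  rewrite -[leRHS]sum1 (bigID [pred k | s k == r])/=.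
  rewrite (eq_bigr (fun=> x)); last by move=> k /eqP /Dl.
  rewrite sumr_const mulr_natl lerDl sumr_ge0// => k _.
  exact: resp_ge0.
have S0 : \sum_(k < d.+1 | ~~ chi k) resp O MD k%:R l =
    #|[pred k | ~~ chi k]|%:R * x.
  rewrite (eq_bigr (fun=> x)); last by move=> k ck; rewrite Dl// schi.
  by rewrite sumr_const mulr_natl.
have : 1 - \sum_(k < d.+1 | ~~ chi k) resp O MD k%:R l <= resp O MA a l.
  rewrite -[X in X - _]sum1 (bigID chi)/= addrK J1 fsum_eigval_diagobs ?hdim_gt0//.
  rewrite [leRHS](bigID chi)/= (eq_bigr (fun k : 'I__ => J a k%:R l)); last first.
    by move=> k /Jl.
  by rewrite lerDl sumr_ge0.
apply: le_trans; rewrite S0 lerD2l lerN2 ler_wpM2l//.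
by rewrite -[leRHS]mul1r ler_pdivlMr ?ltr0n// mulrC.
Qed.

End ChainedBell.

(** * Lower bounds on response functions *)

Lemma qprob_tens1 (R : realType) n m (rho E : 'M[R[i]]_n) (rho2 : 'M[R[i]]_m) :
  \tr rho2 = 1 -> qprob (rho *t rho2) (E *t 1%:M) = qprob rho E.
Proof.
by move=> tr1; rewrite /qprob tensmx_mul mulmx1 mxtrace_tens tr1 mulr1.
Qed.

Section Transfer.
Variables (R : realType) (CM : complete_model R).
Hypotheses (ui : CM_unitary_invariant CM) (pi : CM_parameter_independent CM).

(** The response p(a|l) is the average of the joint response over [anc CM P2 l], and the bound holds
    almost surely for almost every one of these components. *)
Lemma ancilla_ae h1 h2 (M : Meas (sys CM h1)) (M' : Meas (sys CM (HTens h1 h2)))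
    (P1 : Prep (sys CM h1)) (P2 : Prep (sys CM h2))
    (P12 : Prep (sys CM (HTens h1 h2))) (a c : R) :
  (forall l, (resp (om CM h1) M a l)%:E =
     \int[anc CM P2 l]_l' (resp (om CM (HTens h1 h2)) M' a l')%:E)%E ->
  (forall D, measurable D -> prep (om CM (HTens h1 h2)) P12 D =
     (\int[prep (om CM h1) P1]_l anc CM P2 l D))%E ->
  {ae prep (om CM (HTens h1 h2)) P12, forall l,
     c <= resp (om CM (HTens h1 h2)) M' a l} ->
  {ae prep (om CM h1) P1, forall l, c <= resp (om CM h1) M a l}.
Proof.
move=> MM' P12E /(mixture_ae P12E); apply: filterS => l cl.
rewrite -lee_fin MM'; apply: ae_ge_integral => //.
- exact: prob_kernel.
- exact: resp_measurable.
- exact: resp_ge0.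
Qed.

(* The second ancilla carries the entangled state of C^(d+1) and a copy of the
   system. Swapping the system with its copy entangles it with C^(d+1) without
   changing the probability of [a], so unitary invariance applies whether or not
   the initial state is pure. *)
Lemma isom_lower_bound (ai : CM_ancilla_independent CM) h
    (P : Prep (sys CM h)) (M : Meas (sys CM h)) a d
    (F : 'M[R[i]]_(hdim h, d.+1)) (s : 'I_d.+1 -> R) (chi : pred 'I_d.+1)
    (k0 : 'I_d.+1) (r : R) :
  eigval (obs_of M) a -> adjmx F *m F = 1%:M -> \sum_k s k ^+ 2 = 1 ->
  adjmx F *m eigproj (obs_of M) a *m F = diag_mx (\row_k (chi k)%:R) ->
  \sum_(k | chi k) s k ^+ 2 = qprob (rho_of P) (eigproj (obs_of M) a) ->
  s k0 = r -> (forall k, ~~ chi k -> s k = r) ->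
  {ae prep (om CM h) P, forall l,
    1 - #|[pred k | ~~ chi k]|%:R / #|[pred k | s k == r]|%:R
      <= resp (om CM h) M a l}.
Proof.
move=> Aa F1 s1 Achi sq sk0 schi; pose hB := HTens (HBase d) h.
have dens := entstate_density F1 s1.
have [P2 P2E] := rho_of_surj (sys CM hB) dens.
have [M' [M'E MM']] := ai h hB M.
have [P12 [rP12 P12E]] := anc_prep P2 P.
have [T TE] := uop_of_surj (sys CM (HTens h hB)) (swapmx_unitary R (hdim h) d.+1).
have [nu [nuD nuI]] :=
  mixture_exists (prep (om CM (HTens h hB)) P12) (trans (om CM (HTens h hB)) T).
have [MD MDE] : exists MD : Meas (sys CM (HTens h hB)),
    obs_of MD = bobs h (diagobs R d.+1).
  apply: obs_of_surj; apply: self_adjoint_tens; first exact: adjmx1.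
  by apply: self_adjoint_tens; [exact: diagobs_adj|exact: adjmx1].
have tr1 : \tr (rho_of P) = 1 by case: (rho_of_density P).
have PE : rho_of P12 = rho_of P *t entstate F s by rewrite rP12 P2E.
have A'a : eigval (obs_of M') a.
  by rewrite M'E (eigval_tensl _ (hdim_gt0 hB))//; exact: obs_of_sa.
apply: (ancilla_ae (MM' P2 a) P12E).
(* For almost every ontic state before the swap, the bound holds almost surely after it. *)
have /(mixture_ae nuD) cae :=
  ae_resp_transported_ge pi F1 tr1 PE TE nuI M'E MDE Aa Achi sk0 schi.
have A'E : eigproj (obs_of M') a = eigproj (obs_of M) a *t 1%:M.
  by rewrite M'E; apply/is_eigproj_eq/is_eigproj_tensl/eigprojP.
have : {ae prep (om CM (HTens h hB)) P12, forall l,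
    (resp (om CM (HTens h hB)) M' a l)%:E =
    (\int[trans (om CM (HTens h hB)) T l]_l'
      (resp (om CM (HTens h hB)) M' a l')%:E)%E}.
  (* Before the swap the outcome has its probability in [rho_of P], after it the sum of s_k^2 over
     [chi]; these are equal by hypothesis. *)
  apply: ui => //; rewrite A'E (qprob_sig1 tr1 PE TE) PE.
  rewrite qprob_tens1; last by case: dens.
  rewrite -sq entprob1r Achi.
  rewrite (eq_bigr (fun k => (s k ^+ 2 * (chi k)%:R)%:C%C)); last first.
    by move=> k _; rewrite !mxE eqxx; case: (chi k); rewrite ?(mulr1, mulr0).
  rewrite -rmorph_sum/= big_mkcond; apply: eq_bigr => k _.
  by case: (chi k); rewrite ?mulr1 ?mulr0.
apply: filterS2 cae => l cl rl.
rewrite -lee_fin rl; apply: ae_ge_integral => //.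
- exact: prob_kernel.
- exact: resp_measurable.
- exact: resp_ge0.
Qed.

End Transfer.

Lemma proj_density (R : realType) n (E : 'M[R[i]]_n) :
  adjmx E = E -> E *m E = E -> \tr E = 1 -> density E.
Proof.
move=> Es EE tr1; split=> // x.
have -> : adjmx x *m E *m x = adjmx (E *m x) *m (E *m x).
  by rewrite adjmxM Es !mulmxA -(mulmxA _ E E) EE.
exact: adjmx_sq_ge0.
Qed.

Lemma density_exists (R : realType) n : exists rho : 'M[R[i]]_n.+1, density rho.
Proof.
exists (delta_mx 0 0); apply: proj_density; first exact: adjmx_delta.
  by rewrite mul_delta_mx.
by rewrite /mxtrace (bigD1 0)//= big1 ?addr0 ?mxE// => i /negbTE i0;
  rewrite mxE i0.
Qed.

Lemma proj_unit_vector (R : realType) n (E : 'M[R[i]]_n) :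
  E *m E = E -> E != 0 ->
  exists2 u : 'cV[R[i]]_n, adjmx u *m u = 1%:M & E *m u = u.
Proof.
move=> EE /matrix0Pn[i [j Eij]].
have Ej : col j E != 0 by apply/matrix0Pn; exists i, 0; rewrite mxE.
have [c cu] := unit_scaling Ej; exists (c%:C%C *: col j E) => //.
by rewrite -scalemxAr colE mulmxA EE.
Qed.

(** * Choice of the weights *)

Section Weights.
Variables (R : realType) (K0 K1 : nat) (w al : R).
Hypotheses (w0 : 0 <= w) (al0 : 0 <= al).
Local Notation d := (K0 + K1)%N.

(* K0 outcomes outside the eigenspace and K1 inside have weight w; the last one,
   inside, has the weight al < w that makes the total probability exact. *)
Definition wamp (k : 'I_d.+1) : R :=
  if (k < d)%N then Num.sqrt w else Num.sqrt al.
Definition wchi : pred 'I_d.+1 := fun k => (K0 <= k)%N.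

Lemma sum_wamp : \sum_k wamp k ^+ 2 = d%:R * w + al.
Proof.
rewrite big_ord_recr/= /wamp/= ltnn sqr_sqrtr//; congr (_ + _).
under eq_bigr do rewrite ltn_ord sqr_sqrtr//.
by rewrite sumr_const card_ord mulr_natl.
Qed.

Lemma sum_wamp_chi : \sum_(k | wchi k) wamp k ^+ 2 = K1%:R * w + al.
Proof.
rewrite big_mkcond big_ord_recr/= /wamp/= ltnn /wchi/= leq_addr sqr_sqrtr//.
congr (_ + _); rewrite big_split_ord/= big1 ?add0r => [|i _]; last first.
  by rewrite leqNgt ltn_ord.
under eq_bigr => i _ do rewrite leq_addr ltn_add2l ltn_ord sqr_sqrtr//.
by rewrite sumr_const card_ord mulr_natl.
Qed.

Lemma card_wchiN : #|[pred k | ~~ wchi k]| = K0.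
Proof.
rewrite -sum1_card big_mkcond big_ord_recr/= inE /wchi/= leq_addr addn0.
rewrite big_split_ord/= [X in (_ + X)%N]big1 ?addn0 => [|i _]; last first.
  by rewrite inE /= leq_addr.
under eq_bigr => i _ do rewrite inE /= -ltnNge ltn_ord.
by rewrite sum1_card card_ord.
Qed.

(** Only an inequality, since the last index also counts when [al] equals [w]; a larger count just
    improves the bound. *)
Lemma card_wamp : (d <= #|[pred k | wamp k == Num.sqrt w]|)%N.
Proof.
rewrite -sum1_card big_mkcond big_ord_recr/=.
apply: leq_trans (leq_addr _ _).
under eq_bigr => i _ do rewrite inE /wamp /= ltn_ord eqxx.
by rewrite sum1_card card_ord.
Qed.

End Weights.

Section LowerBound.
Variables (R : realType) (CM : complete_model R).
Hypotheses (ai : CM_ancilla_independent CM) (ui : CM_unitary_invariant CM)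
  (pi : CM_parameter_independent CM).
Variables (h : hspace) (P : Prep (sys CM h)) (M : Meas (sys CM h)) (a : R).
Hypothesis Aa : eigval (obs_of M) a.
Let Q := eigproj (obs_of M) a.
Let q := qprob (rho_of P) Q.

Lemma weighted_lower_bound K0 K1 (w al : R) : (0 < K0)%N ->
  0 <= w -> 0 <= al -> (K0 + K1)%:R * w + al = 1 -> K1%:R * w + al = q ->
  Q != 0 -> 1%:M - Q != 0 ->
  {ae prep (om CM h) P, forall l,
    1 - K0%:R / (K0 + K1)%:R <= resp (om CM h) M a l}.
Proof.
move=> K00 w0 al0 sum1 sumq Q0 Q1.
have QQ : Q *m Q = Q := is_eigproj_idem (eigprojP _ _).
have CQ : (1%:M - Q) *m (1%:M - Q) = 1%:M - Q.
  by rewrite mulmxBr mulmx1 mulmxBl mul1mx QQ subrr subr0.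
have [u uu Qu] := proj_unit_vector QQ Q0.
have [u' uu' CQu] := proj_unit_vector CQ Q1.
have Qu' : Q *m u' = 0.
  by rewrite -CQu mulmxA mulmxBr mulmx1 QQ subrr mul0mx.
set d := (K0 + K1)%N; pose hd := HBase d.
(* Any state of the first ancilla will do: this ancilla only makes room for d + 1 orthonormal
   vectors built from [u] and [u']. *)
have [rho2 dens2] := density_exists R d.
have [P2 P2E] := rho_of_surj (sys CM hd) dens2.
have [M' [M'E MM']] := @ai h hd M.
have [P12 [rP12 P12E]] := anc_prep P2 P.
have A'a : eigval (obs_of M') a.
  by rewrite M'E eigval_tensl//; exact: obs_of_sa.
have A'E : eigproj (obs_of M') a = Q *t 1%:M.
  by rewrite M'E; apply/is_eigproj_eq/is_eigproj_tensl/eigprojP.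
pose chi := @wchi K0 K1.
pose v k := if chi k then u else u'.
pose F := tens_family v.
have F1 : adjmx F *m F = 1%:M.
  have := tens_family_conj v 1%:M; rewrite tensmx11 mulmx1 => ->.
  apply/matrixP => i j; rewrite !mxE mulmx1 /v.
  by case: (chi i); rewrite ?uu ?uu' mxtrace1.
have Achi : adjmx F *m eigproj (obs_of M') a *m F =
    diag_mx (\row_k (chi k)%:R).
  rewrite A'E tens_family_conj; congr diag_mx; apply/matrixP => i k.
  rewrite !mxE /v; case: (chi k); rewrite -mulmxA ?Qu ?Qu' ?uu ?mxtrace1//.
  by rewrite mulmx0 mxtrace0.
have := @isom_lower_bound R CM ui pi ai (HTens h hd) P12 M' a d F
  (@wamp R K0 K1 w al) chi ord0 (Num.sqrt w) A'a F1 _ Achi.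
rewrite sum_wamp// sum1 => /(_ erefl); rewrite sum_wamp_chi// sumq.
rewrite A'E rP12 P2E qprob_tens1; last by case: dens2.
move=> /(_ erefl).
(* The index 0 can serve as the reference of amplitude sqrt w because K0 > 0. *)
have wa0 : @wamp R K0 K1 w al ord0 = Num.sqrt w.
  by rewrite /wamp /= addn_gt0 K00.
move=> /(_ wa0) H.
have {H} : {ae prep (om CM (HTens h hd)) P12, forall l,
    1 - K0%:R / d%:R <= resp (om CM (HTens h hd)) M' a l}.
  have := H _; rewrite card_wchiN => H'.
  apply: filterS (H' _) => [l|k]; last first.
    rewrite /chi /wchi /wamp -ltnNge => kK.
    by rewrite (leq_trans kK)// leq_addr.
  apply: le_trans; rewrite lerD2l lerN2 ler_wpM2l//.
  have dp : (0 < d)%N by rewrite addn_gt0 K00.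
  rewrite lef_pV2 ?posrE ?ltr0n//; last exact: leq_trans dp (card_wamp _ _ _ _).
  by rewrite ler_nat card_wamp.
exact: (ancilla_ae (MM' P2 a) P12E).
Qed.

Lemma resp_lower_bound e : 0 < e -> 0 < q -> q < 1 ->
  {ae prep (om CM h) P, forall l, q - e <= resp (om CM h) M a l}.
Proof.
move=> e0 q0 q1.
have [_ _ tr1] := rho_of_density P.
have Q0 : Q != 0.
  apply: contraTneq q0 => Q0; rewrite /q /qprob Q0 mulmx0 mxtrace0.
  by rewrite ltxx.
have Q1 : 1%:M - Q != 0.
  rewrite subr_eq0; apply: contraTneq q1 => Q1.
  by rewrite /q /qprob -Q1 mulmx1 tr1 /= ltxx.
(* The weight 1 - q is shared equally by K0 vectors of the kernel; K0 exceeds (1 - q) / e, so each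
   share w is at most e. *)
pose K0 := (Num.truncn ((1 - q) / e)).+1.
have K0p : 0 < K0%:R :> R by rewrite ltr0n.
pose w := (1 - q) / K0%:R.
have wp : 0 < w by rewrite divr_gt0// subr_gt0.
have we : w <= e.
  rewrite ler_pdivrMr// [leRHS]mulrC -ler_pdivrMr// ltW//.
  exact: truncnS_gt.
(* As many shares w as fit into q go to the range; the remainder [al] is less than w. *)
pose K1 := Num.truncn (q / w).
have /andP[K1l K1u] : K1%:R <= q / w < K1.+1%:R.
  by apply: truncn_itv; rewrite divr_ge0// ltW.
pose al := q - K1%:R * w.
have al0 : 0 <= al by rewrite subr_ge0 -ler_pdivlMr.
have alw : al < w.
  by rewrite ltrBlDl -[X in _ + X]mul1r -mulrDl natr1 -ltr_pdivrMr.
have wK : K0%:R * w = 1 - q by rewrite mulrC divfK// gt_eqF.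
have sum1 : (K0 + K1)%:R * w + al = 1.
  by rewrite natrD mulrDl wK /al; ring.
have sumq : K1%:R * w + al = q by rewrite /al; ring.
have := @weighted_lower_bound K0 K1 w al isT (ltW wp) al0 sum1 sumq Q0 Q1.
apply: filterS => l; apply: le_trans.
have Kp : 0 < (K0 + K1)%:R :> R by rewrite ltr0n.
(* Multiplied by w, the quotient is (1 - q) / (1 - al). Since al < w <= e, the difference (1 - q +
   e) (1 - al) - (1 - q) is at least al (q - al) >= 0. *)
suff : K0%:R / (K0 + K1)%:R <= 1 - q + e by lra.
rewrite ler_pdivrMr// -(ler_pM2r wp) -mulrA wK.
have -> : (K0 + K1)%:R * w = 1 - al by lra.
have K1w : 0 <= K1%:R * w by rewrite mulr_ge0// ltW.
have : al * (q - al) >= 0 by rewrite mulr_ge0// /al; lra.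
have : 0 <= 1 - al by lra.
by nra.
Qed.

End LowerBound.

(** * Conclusion, with the extreme probabilities treated apart *)

Lemma resp_le1 (R : realType) n (S : qsystem R n) (O : ontic_model S) M a l :
  resp O M a l <= 1.
Proof.
have [Ma|/resp_supp ->] := boolP (eigval (obs_of M) a); last exact: ler01.
rewrite -(resp_sum1 M l).
apply: (@fsum_ge_term _ _ _ (resp O M ^~ l)) => //.
  exact: finite_eigval.
by move=> b; exact: resp_ge0.
Qed.

Theorem theorem3 (R : realType) (CM : complete_model R) :
  CM_ancilla_independent CM ->
  CM_unitary_invariant CM ->
  CM_parameter_independent CM ->
  forall h : hspace, psi_complete (om CM h).
Proof.
move=> ai ui pi h P M a Ma.
set q := qprob _ _.
have Iq : (\int[prep (om CM h) P]_l (resp (om CM h) M a l)%:E = q%:E)%E.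
  exact: reprod.
have mr : measurable_fun setT (resp (om CM h) M a) := resp_measurable M a.
have r0 l : 0 <= resp (om CM h) M a l by exact: resp_ge0.
have P1 : prep (om CM h) P setT = 1%E by exact: probability_setT.
(* The construction requires 0 < q < 1, which makes both range and kernel of the eigenprojection
   nonzero. For q <= 0 nonnegativity of the response suffices. *)
have [q0|q0] := leP q 0.
  apply: (ae_lower_bound_L1 P1 mr r0 Iq) => e e0; apply: aeW => l.
  by apply: le_trans (r0 l); lra.
have [q1|q1] := ltP q 1.
  apply: (ae_lower_bound_L1 P1 mr r0 Iq) => e e0.
  exact: resp_lower_bound.
(* For q >= 1 the response is compared with the constant 1 that dominates it: their L1 distance is
   at most q + 1 - 2 q = 1 - q <= 0. *)
have I1 : (\int[prep (om CM h) P]_l (cst 1%R l)%:E = 1%:E)%E.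
  exact: integral_cst1 P1.
have r1 l : resp (om CM h) M a l <= cst 1 l by exact: resp_le1.
have := L1close_joint mr (measurable_cst _) mr r0 (fun=> lexx _) r1 Iq I1 Iq.
rewrite /L1close => Ile.
have I0 : (0 <= \int[prep (om CM h) P]_l `|resp (om CM h) M a l - cst 1 l|%:E)%E.
  by apply: integral_ge0 => l _; rewrite lee_fin.
have qE : q = 1.
  apply/eqP; rewrite eq_le q1 andbT.
  by have := le_trans I0 Ile; rewrite lee_fin; lra.
rewrite qE; apply/eqP; rewrite eq_le [X in _ && X]I0 andbT.
apply: le_trans Ile _; rewrite lee_fin qE; lra.
Qed.
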